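(* Let $H\in(0,1)$. Let $\mu$ be the self-similar measure on $[0,1]$ generated by an iterated function system $\{S_i\}_{i=0}^{m-1}$ satisfying the convex open set condition and a probability vector $(p_0,\dots,p_{m-1})$, and let $V(x)=\mu[0,x]$, $x\in[0,1]$. Let $X^H(t)=B^H_{V(t)}$, where $B^H$ is fractional Brownian motion with Hurst index $H$. Then, almost surely, $$\dim_H\mathcal{G}(X^H,[0,1])=1-\tau_\mu(H).$$
   Context: The iterated function system consists of maps $S_i(x)=r_ix+d_i$, $i=0,\dots,m-1$, with $0<r_i<1$ and $0=d_0\le d_1<\dots<d_{m-1}=1-r_{m-1}$. The probability vector satisfies $p_i>0$ and $\sum_i p_i=1$. The self-similar measure $\mu$ is the unique Borel probability measure with $\mu(E)=\sum_{i=0}^{m-1}p_i\,\mu(S_i^{-1}(E))$ for all Borel $E$. The convex open set condition means $S_i((0,1))\cap S_j((0,1))=\emptyset$ for all $i\ne j$. Fractional Brownian motion $(B^H_t)_{t\ge0}$ with Hurst index $H$ is the continuous centered Gaussian process with $B^H_0=0$ and $B^H_t-B^H_s\sim N(0,|t-s|^{2H})$. The graph is $\mathcal{G}(X,E)=\{(t,X(t)):t\in E\}\subset\mathbb{R}^2$, and $\dim_H$ is Hausdorff dimension. The $L^q$ spectrum of $\mu$ is $$\tau_\mu(q)=\liminf_{r\to0}\frac{1}{\log r}\log\Big(\sup_{\mathcal{B}}\sum_{B\in\mathcal{B}}\mu(B)^q\Big),$$ where the supremum is over all families $\mathcal{B}$ of pairwise disjoint closed balls of radius $r$ with centers in the support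 of $\mu$. *)

(* Defs.v *)
From HB Require Import structures.
From mathcomp Require Import all_boot all_order all_algebra.
From mathcomp Require Import all_classical all_reals all_analysis.

Set Implicit Arguments.
Unset Strict Implicit.
Unset Printing Implicit Defensive.

Import Order.TTheory GRing.Theory Num.Theory.
Import numFieldNormedType.Exports.

Local Open Scope classical_set_scope.
Local Open Scope ring_scope.

Section SelfSimilar.
Context {R : realType} {m : nat}.
Implicit Types (r d p : 'I_m -> R) (mu : probability (measurableTypeR R) R).

Definition ifs_map r d (i : 'I_m) (x : R) : R := r i * x + d i.

(* The chain 0 = d_0 <= d_1 < ... < d_(m-1) = 1 - r_(m-1); strictness is only
   asked from index 1 on. The conditions on the end points force 2 <= m as soon
   as m > 0. *)
Record is_ifs r d : Prop := {
  ifs_ratio : forall i, 0 < r i < 1 ;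
  ifs_first : forall i, val i = 0%N -> d i = 0 ;
  ifs_mono : forall i j : 'I_m, (i < j)%N -> d i <= d j ;
  ifs_smono : forall i j : 'I_m, (0 < i < j)%N -> d i < d j ;
  ifs_last : forall i : 'I_m, i.+1 = m -> d i = 1 - r i }.

Definition is_prob_vector p : Prop :=
  (forall i, 0 < p i) /\ \sum_(i < m) p i = 1.

Definition convex_open_set_condition r d : Prop :=
  forall i j : 'I_m, i != j ->
    (ifs_map r d i @` `]0, 1[) `&` (ifs_map r d j @` `]0, 1[) = set0.

Definition is_self_similar_measure r d p mu : Prop :=
  forall E : set (measurableTypeR R), measurable E ->
    mu E = (\sum_(i < m) (p i)%:E * mu (ifs_map r d i @^-1` E))%E.

End SelfSimilar.

Section LqSpectrum.
Context {R : realType}.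
Implicit Types (mu : probability (measurableTypeR R) R).

Definition measure_support mu : set R :=
  [set x | forall e : R, 0 < e -> (0 < mu (ball x e))%E].

Definition is_packing mu (r : R) (F : set (set R)) : Prop :=
  (forall C, F C -> exists2 x, measure_support mu x & C = closed_ball x r) /\
  trivIset F id.

Definition packing_sum mu (q r : R) : \bar R :=
  ereal_sup [set (\esum_(C in F) (mu C `^ q))%E | F in is_packing mu r].

Definition lq_spectrum mu (q : R) : \bar R :=
  limf_einf (fun r : R => ((ln r)^-1%:E * lne (packing_sum mu q r))%E) 0^'+.

Definition mass_from0 mu (x : R) : R := fine (mu `[0, x]%classic).

End LqSpectrum.

Section FractionalBrownianMotion.
Context {R : realType}.

(* N(a, v) with v the variance; the library's normal_prob takes the standard
   deviation, and its value at 0 is not the degenerate law. *)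
Definition normal_law (a v : R) (A : set (measurableTypeR R)) : \bar R :=
  if v == 0 then \d_a A else normal_prob a (Num.sqrt v) A.

Context {d : measure_display} {T : measurableType d} (P : probability T R).

Definition has_normal_law (Y : T -> R) (a v : R) : Prop :=
  forall A : set (measurableTypeR R), measurable A ->
    P (Y @^-1` A) = normal_law a v A.

Definition gaussian_process (X : R -> {RV P >-> R}) : Prop :=
  forall (n : nat) (t c : 'I_n -> R), (forall i, 0 <= t i) ->
    exists a v : R, 0 <= v /\
      has_normal_law (fun w => \sum_(i < n) c i * X (t i) w) a v.

(* Processes are indexed by R, but only the indices t >= 0 matter. *)
Record is_fbm (H : R) (B : R -> {RV P >-> R}) : Prop := {
  fbm_gaussian : gaussian_process B ;
  fbm_centered : forall t, 0 <= t -> ('E_P[B t] = 0)%E ;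
  fbm_continuous :
    {ae P, forall w, {within `[0, +oo[, continuous (fun t => B t w)}} ;
  fbm_start : {ae P, forall w, B 0 w = 0} ;
  fbm_increments : forall s t, 0 <= s -> 0 <= t ->
    has_normal_law (fun w => B t w - B s w) 0 (`|t - s| `^ (2 * H)) }.

End FractionalBrownianMotion.

Section HausdorffDimension.
Context {R : realType}.
Implicit Types (A U : set (R * R)) (s delta : R).

(* The library's metric on R * R is the max metric. *)
Definition dist2 (x y : R * R) : R :=
  Num.sqrt ((x.1 - y.1) ^+ 2 + (x.2 - y.2) ^+ 2).

(* -oo on the empty set *)
Definition diam2 U : \bar R :=
  ereal_sup [set (dist2 x.1 x.2)%:E | x in U `*` U].

(* diam(U)^s, with value 0 on the empty set for every s and 0^0 = 1 *)
Definition hausdorff_gauge s U : \bar R :=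
  if U == set0 then 0%E else (diam2 U `^ s)%E.

Definition hausdorff_content s delta A : \bar R :=
  ereal_inf [set (\sum_(0 <= n <oo) hausdorff_gauge s (U n))%E |
    U in [set U : nat -> set (R * R) |
      A `<=` \bigcup_n U n /\ forall n, (diam2 (U n) <= delta%:E)%E]].

Definition hausdorff_measure s A : \bar R :=
  ereal_sup [set hausdorff_content s delta A | delta in [set e : R | 0 < e]].

Definition hausdorff_dim A : \bar R :=
  ereal_inf [set s%:E | s in [set s : R | 0 <= s /\ hausdorff_measure s A = 0%E]].

Definition graph_on (X : R -> R) (E : set R) : set (R * R) :=
  [set (t, X t) | t in E].

End HausdorffDimension.

(* Main.v *)
Require Import Defs.
From HB Require Import structures.
From mathcomp Require Import all_boot all_order all_algebra.
From mathcomp Require Import all_classical all_reals all_analysis.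
From mathcomp Require Import measurable_realfun.
From mathcomp Require Import ring lra zify.

Set Implicit Arguments.
Unset Strict Implicit.
Unset Printing Implicit Defensive.

Import Order.TTheory GRing.Theory Num.Theory.
Import numFieldNormedType.Exports.

Local Open Scope classical_set_scope.
Local Open Scope ring_scope.

(** Write Phi(h, t) = sum_i p_i^h r_i^t, the pressure sum, and let s > 0 be the
    zero of the pressure at H, that is Phi(H, s) = 1. Both sides of the claim are
    computed separately: tau_mu(H) = - s, and the graph has dimension 1 + s almost
    surely.

    Upper bounds. Let M(rho) be the supremum of sum_c mu[c - rho, c + rho]^h over
    the centers of disjoint intervals. By self-similarity and subadditivity of the
    h-th power, M(rho) <= sum_i p_i^h M(rho / r_i), and M is bounded at scale 1
    because at most two disjoint intervals of half length at least 1 meet [0, 1].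
    If Phi(h, t) <= 1, iteration gives M(rho) <= C rho^(-t)
    ([packing_moment_bound]). For h = H this bounds the packing sums of mu. On a
    regular grid with N steps it also bounds the sum of the h-th powers of the
    masses of the steps by C N^t; for h < H the paths of B are Hoelder continuous
    with exponent h ([fbm_holder]), so these powers bound the oscillations of X on
    the steps, and the graph is covered by about N^(1 + t) squares of side 1 / N
    ([graph_dim_le]). Since Phi is continuous in h, any t > s is reached.

    Lower bounds. Let t < s, so that Phi(H, t) > 1. Expanding a large power of
    Phi(H, t) as a sum over words and keeping only the words with the most
    productive letter counts costs a polynomial factor. This yields finitely many
    similarities with the same ratio rho and the same weight pi, #J pi^H rho^t >= 1,
    whose images of [0, 1] are separated by gaps which have positive mass
    ([exists_subsystem]). The balls around the points of level n of this subsystem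
    bound the packing sums from below. For the graph, take the uniform measure on
    the points of level n and its energy for a truncated Riesz kernel of exponent
    g < 1 + t. If two points separate after l letters, their time parameters
    V(x), V(y) differ by at least a constant times pi^l, thus |X(x) - X(y)| <= a
    has probability at most a constant times a / pi^(l H); together with
    #J pi^H rho^t >= 1 this makes the expected energy bounded in n
    ([energy_mean]). By Fatou's lemma the energies stay bounded along a random
    sequence of levels. As mu has no atoms ([self_similar_atomless]), X is
    continuous, so covers of the graph reduce to finite ones, and a finite form of
    Frostman's argument ([frostman_finite]) bounds their sums from below
    ([graph_dim_ge]). *)

(** * Elementary real analysis *)

Section RealTools.
Context {R : realType}.
Implicit Types (x y h t : R).

Lemma powR_subadditive h x y : 0 < h <= 1 -> 0 <= x -> 0 <= y ->
  (x + y) `^ h <= x `^ h + y `^ h.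
Proof.
move=> /andP[h0 h1] x0 y0.
have [s0|s0] := eqVneq (x + y) 0.
  by rewrite s0 powR0 ?gt_eqF// addr_ge0 ?powR_ge0.
have sgt0 : 0 < x + y by rewrite lt_neqAle eq_sym s0 addr_ge0.
(* each share q of the whole is at most its own h-th power *)
have share q : 0 <= q <= 1 -> q <= q `^ h.
  move=> /andP[q0 q1]; have [->|qn0] := eqVneq q 0; first exact: powR_ge0.
  by apply: ger1_powR => //; rewrite lt_neqAle eq_sym qn0 q0.
have q0 z : 0 <= z -> 0 <= z / (x + y) by move=> z0; rewrite divr_ge0 // ltW.
have qE z : 0 <= z -> z `^ h = (x + y) `^ h * (z / (x + y)) `^ h.
  by move=> z0; rewrite -powRM ?q0// ?ltW// mulrC divfK.
rewrite (qE x)// (qE y)// -mulrDr ler_peMr ?powR_ge0//.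
have {1}-> : 1 = x / (x + y) + y / (x + y) by rewrite -mulrDl divff.
by apply: lerD; apply: share; rewrite q0//= ler_pdivrMr// mul1r ?lerDl ?lerDr.
Qed.

Lemma powR_prod (I : Type) (s : seq I) (F : I -> R) h : (forall i, 0 <= F i) ->
  (\prod_(i <- s) F i) `^ h = \prod_(i <- s) F i `^ h.
Proof.
move=> F0; elim: s => [|i s IH]; first by rewrite !big_nil powR1.
by rewrite !big_cons powRM ?prodr_ge0// IH.
Qed.

Lemma powR_sum_subadditive (I : Type) (s : seq I) (F : I -> R) h :
  0 < h <= 1 -> (forall i, 0 <= F i) ->
  (\sum_(i <- s) F i) `^ h <= \sum_(i <- s) F i `^ h.
Proof.
move=> hh F0; elim: s => [|i s IH].
  by rewrite !big_nil powR0//; case/andP: hh => /gt_eqF ->.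
rewrite !big_cons (le_trans (powR_subadditive hh _ _))//.
  by rewrite sumr_ge0.
by rewrite lerD2l.
Qed.

Lemma expR_ge_expr x k : 0 <= x -> (x / k.+1%:R) ^+ k.+1 <= expR x.
Proof.
move=> x0; have k0 : (k.+1%:R : R) != 0 by rewrite pnatr_eq0.
rewrite -[in leRHS](divfK k0 x) expRM_natr lerXn2r ?nnegrE ?expR_ge0 ?divr_ge0//.
by apply: le_trans (expR_ge1Dx _); rewrite lerDr.
Qed.

Lemma expr_beats_poly (b K : R) m : 1 < b ->
  exists n, K * n.+1%:R ^+ m <= b ^+ n.
Proof.
move=> b1; have b0 : 0 < b by apply: lt_trans b1.
pose l := ln b; have l0 : 0 < l by rewrite ln_gt0.
pose c := (l / m.+1%:R) ^+ m.+1.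
have c0 : 0 < c by rewrite exprn_gt0// divr_gt0.
have [n nK] : exists n, (`|K| * 2 ^+ m / c) <= n.+1%:R.
  exists (Num.truncn (`|K| * 2 ^+ m / c)).
  by rewrite ltW// truncnS_gt.
exists n.+1.
have -> : b ^+ n.+1 = expR (n.+1%:R * l).
  by rewrite expRM_natl lnK// posrE.
apply: le_trans (expR_ge_expr m _); last by rewrite mulr_ge0// ltW.
rewrite -mulrA exprMn -/c.
apply: (@le_trans _ _ (`|K| * (2 * n.+1%:R) ^+ m)).
  rewrite (le_trans (ler_wpM2r _ (ler_norm K))) ?exprn_ge0//.
  rewrite ler_wpM2l// lerXn2r ?nnegrE// -natrM ler_nat; lia.
rewrite exprMn mulrA exprS mulrAC ler_wpM2r ?exprn_ge0//.
by rewrite -ler_pdivrMr.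
Qed.

Lemma geometric_sum_le (q : R) n : 0 <= q < 1 ->
  \sum_(k < n) q ^+ k <= (1 - q)^-1.
Proof.
move=> /andP[q0 q1]; have d0 : 0 < 1 - q by rewrite subr_gt0.
have qE : (1 - q) * \sum_(k < n) q ^+ k = 1 - q ^+ n.
  by rewrite -[in LHS]opprB mulNr -subrX1 opprB.
by rewrite -(ler_pM2l d0) qE divff ?gt_eqF// gerBl exprn_ge0.
Qed.

Lemma geometric_sum_le_last (q : R) n : 1 < q ->
  \sum_(k < n) q ^+ k <= q ^+ n / (q - 1).
Proof.
move=> q1; have d0 : 0 < q - 1 by rewrite subr_gt0.
by rewrite ler_pdivlMr// mulrC -subrX1 lerBlDr lerDl.
Qed.

Lemma powR_expr x h n : 0 <= x -> (x ^+ n) `^ h = (x `^ h) ^+ n.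
Proof.
move=> x0; rewrite -(powR_mulrn n x0) powRAC.
by rewrite (powR_mulrn n (powR_ge0 x h)).
Qed.

Lemma le_powR_base h x y : 0 <= h -> 0 <= x -> x <= y -> x `^ h <= y `^ h.
Proof.
by move=> h0 x0 xy; apply: ge0_ler_powR => //; rewrite nnegrE// (le_trans x0).
Qed.

Lemma powR_le1 x h : 0 <= h -> 0 <= x <= 1 -> x `^ h <= 1.
Proof.
move=> h0 /andP[x0 x1]; have <- : 1 `^ h = 1 by rewrite powR1.
exact: le_powR_base.
Qed.

Lemma powR_continuous_exponent x : 0 < x -> continuous (fun t => x `^ t).
Proof.
move=> x0; rewrite (_ : (fun t => _) = expR \o (fun t => t * ln x)); last first.
  by apply/funext => t /=; rewrite /powR gt_eqF.
move=> t; apply: continuous_comp; last exact: continuous_expR.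
by apply: cvgM; [exact: cvg_id|exact: cvg_cst].
Qed.

End RealTools.

(** * The pressure function and its zero *)

Section Pressure.
Context {R : realType} {m : nat}.
Implicit Types (r p : 'I_m -> R) (h t : R).

Definition pressure_sum r p h t : R := \sum_(i < m) p i `^ h * r i `^ t.

Lemma continuous_sum_fct (I : Type) (s : seq I) (F : I -> R -> R) :
  (forall i, continuous (F i)) -> continuous (fun t => \sum_(i <- s) F i t).
Proof.
move=> Fc; elim: s => [|i s IH] t.
  by under eq_fun do rewrite big_nil; exact: cvg_cst.
under eq_fun do rewrite big_cons.
by apply: cvgD; [exact: Fc|exact: IH].
Qed.

Lemma pressure_sum_continuous r p : (forall i, 0 < p i) -> (forall i, 0 < r i) ->
  (forall h, continuous (pressure_sum r p h)) /\
  (forall t, continuous (pressure_sum r p ^~ t)).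
Proof.
move=> p0 r0; split=> [h|t]; apply: continuous_sum_fct => i u.
  by apply: cvgM; [exact: cvg_cst|exact: powR_continuous_exponent].
by apply: cvgM; [exact: powR_continuous_exponent|exact: cvg_cst].
Qed.

Lemma pressure_sum_decreasing r p h t u : (0 < m)%N ->
  (forall i, 0 < p i) -> (forall i, 0 < r i < 1) -> t < u ->
  pressure_sum r p h u < pressure_sum r p h t.
Proof.
move=> m0 p0 r01 tu; apply: ltr_sum => [|i _].
  by apply/hasP; exists (Ordinal m0); rewrite ?mem_index_enum.
rewrite ltr_pM2l ?powR_gt0//; have /andP[ri0 ri1] := r01 i.
by rewrite /powR !gt_eqF// ltr_expR ltr_nM2r// ln_lt0 ?ri0.
Qed.

Lemma prob_vector_lt1 p : (1 < m)%N -> (forall i, 0 < p i) ->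
  \sum_(i < m) p i = 1 -> forall i, p i < 1.
Proof.
move=> m1 p0 p1 i.
have [j ji] : exists j : 'I_m, j != i.
  have [i0|i0] := eqVneq (val i) 0%N.
    by exists (Ordinal m1); rewrite -val_eqE/= i0.
  by exists (Ordinal (ltnW m1)); rewrite -val_eqE/= eq_sym.
rewrite -p1 (bigD1 i)//= ltrDl (bigD1 j)//= ltr_pwDl//.
by apply: sumr_ge0 => k _; exact: ltW.
Qed.

(** At t = 0 the sum exceeds sum_i p_i = 1, since p_i < p_i^h; and for large t each
    of its m terms is at most 1 / m. *)
Lemma pressure_root r p h : (1 < m)%N -> (forall i, 0 < p i) ->
  \sum_(i < m) p i = 1 -> (forall i, 0 < r i < 1) -> 0 < h < 1 ->
  exists2 s, 0 < s & pressure_sum r p h s = 1.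
Proof.
move=> m1 p0 p1 r01 /andP[h0 h1].
have p_lt1 := prob_vector_lt1 m1 p0 p1.
have gt1 : 1 < pressure_sum r p h 0.
  rewrite -p1; apply: ltr_sum => [|i _].
    by apply/hasP; exists (Ordinal m1); rewrite ?mem_index_enum.
  rewrite powRr0 mulr1 /powR gt_eqF// -[ltLHS]lnK ?posrE//.
  by rewrite ltr_expR -[ltLHS]mul1r ltr_nM2r ?h1// ln_lt0// p0 p_lt1.
have [T T0 TlT] : exists2 T : R, 0 < T & pressure_sum r p h T <= 1.
  pose M := m%:R : R; have M0 : 0 < M by rewrite ltr0n ltnW.
  have [T TP] : exists T : R, forall i, ln M <= T * - ln (r i).
    pose F i := `|ln M| / (- ln (r i)).
    have F0 i : 0 < - ln (r i) by rewrite oppr_gt0 ln_lt0.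
    exists (\sum_i F i) => i.
    rewrite -ler_pdivrMr// (bigD1 i)//= ler_wpDr ?sumr_ge0 => // [j _|].
      by rewrite divr_ge0// ltW.
    by rewrite ler_pM2r ?invr_gt0// ler_norm.
  exists (Num.max 1 T); first by rewrite lt_max ltr01.
  have {2}-> : 1 = \sum_(i < m) M^-1 :> R.
    by rewrite sumr_const card_ord -mulr_natl divff// gt_eqF.
  apply: ler_sum => i _; have /andP[ri0 ri1] := r01 i.
  apply: (@le_trans _ _ (r i `^ Num.max 1 T)).
    by rewrite ler_piMl ?powR_ge0// powR_le1 ?(ltW (p0 i), ltW (p_lt1 i)) ?ltW.
  rewrite /powR gt_eqF// -[leRHS]lnK ?posrE ?invr_gt0// ler_expR lnV ?posrE//.
  rewrite -lerN2 opprK -mulrN (le_trans (TP i))// ler_pM2r ?oppr_gt0 ?ln_lt0//.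
  by rewrite le_max lexx orbT.
have [cont _] := pressure_sum_continuous p0 (fun i => proj1 (andP (r01 i))).
have [] := @IVT R (pressure_sum r p h) 0 T 1 (ltW T0).
- by apply: continuous_subspaceT; exact: cont.
- by rewrite ge_min TlT orbT le_max (ltW gt1).
move=> s /[!in_itv]/= /andP[s0 sT] sE; exists s => //.
rewrite lt_neqAle s0 andbT; apply: contraTneq gt1 => s0'.
by rewrite s0' sE ltxx.
Qed.

End Pressure.

(** * Self-similar measures on the unit interval *)

Lemma finite_pos_lower_bound {R : realType} (I : finType) (F : I -> R) :
  (forall i, 0 < F i) -> exists2 e : R, 0 < e & forall i, e <= F i.
Proof.
move=> F0; have S0 i : 0 <= (F i)^-1 by rewrite invr_ge0 ltW.
exists (1 + \sum_i (F i)^-1)^-1.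
  by rewrite invr_gt0 ltr_pwDl// sumr_ge0.
move=> i; rewrite -[leRHS]invrK lef_pV2 ?posrE ?invr_gt0//; last first.
  by rewrite ltr_pwDl// sumr_ge0.
by rewrite (bigD1 i)//= ler_wpDl// ler_wpDr// sumr_ge0.
Qed.

Section RealLine.
Context {R : realType} (mu : probability (measurableTypeR R) R).

Definition mass (E : set R) : R := fine (mu E).

Lemma massE (E : set R) : measurable E -> mu E = (mass E)%:E.
Proof. by move=> mE; rewrite fineK ?fin_num_measure. Qed.

Lemma mass_ge0 (E : set R) : 0 <= mass E.
Proof. by rewrite fine_ge0. Qed.

Lemma mass_le1 (E : set R) : measurable E -> mass E <= 1.
Proof. by move=> mE; rewrite -lee_fin -massE// probability_le1. Qed.

Lemma le_mass (E F : set R) : measurable E -> measurable F -> E `<=` F ->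
  mass E <= mass F.
Proof. by move=> mE mF EF; rewrite -lee_fin -!massE// le_measure// inE. Qed.

Lemma mass_from0B x y : 0 <= x -> x <= y ->
  mass_from0 mu y - mass_from0 mu x = mass `]x, y].
Proof.
move=> x0 xy; apply/eqP; rewrite subr_eq -eqe EFinD -!massE//; apply/eqP.
rewrite -measureU//; last first.
  by apply/seteqP; split=> // z [] /=; rewrite !in_itv/= => /andP[+ _] /andP[_]; lra.
congr (mu _); apply/seteqP; split=> z /=; rewrite !in_itv/=.
  by move=> /andP[z0 zy]; have [xz|zx] := ltP x z; [left|right]; rewrite ?z0 ?zy.
by move=> [] /andP[]; lra.
Qed.

Lemma mass_from0_le x y : x <= y -> mass_from0 mu x <= mass_from0 mu y.
Proof.
move=> xy; apply: le_mass => // z /=; rewrite !in_itv/= => /andP[-> zx].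
exact: le_trans xy.
Qed.

Lemma mass_from0_01 x : 0 <= mass_from0 mu x <= 1.
Proof. by rewrite mass_ge0 mass_le1. Qed.

Lemma mass_tail (e : R) : 0 < e -> exists K : R, mass (~` `[- K, K]) < e.
Proof.
move=> e0; pose F (n : nat) : set (measurableTypeR R) := ~` `[- n%:R, n%:R].
have mF n : measurable (F n) by apply: measurableC.
have : mu (F n) @[n --> \oo] --> mu (\bigcap_n F n).
  apply: nonincreasing_cvg_mu => //.
  - by rewrite (le_lt_trans (probability_le1 _ _))// ltry.
  - exact: bigcapT_measurable.
  - move=> i j ij; apply/subsetPset => z; apply: contra_not => /=.
    rewrite !in_itv/= => /andP[zi iz].
    have : i%:R <= j%:R :> R by rewrite ler_nat.
    by move=> ij'; apply/andP; split; lra.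
rewrite (_ : \bigcap_n F n = set0); last first.
  apply/seteqP; split=> // z /(_ (Num.truncn `|z|).+1 I); apply => /=.
  by rewrite in_itv/= -ler_norml ltW// truncnS_gt.
rewrite measure0 => /fine_cvgP[_] /cvgrPdist_lt /(_ e e0)[N _ NP].
exists N%:R; have := NP N (leqnn N); rewrite /= sub0r normrN ger0_norm//.
exact: mass_ge0.
Qed.

End RealLine.

Section IteratedFunctionSystem.
Context {R : realType} {m : nat} (r d p : 'I_m -> R).
Hypotheses (hifs : is_ifs r d) (hcosc : convex_open_set_condition r d).
Hypothesis hp : is_prob_vector p.

Let r0 i : 0 < r i. Proof. by have /andP[] := ifs_ratio hifs i. Qed.
Let r1 i : r i < 1. Proof. by have /andP[] := ifs_ratio hifs i. Qed.
Let p0 i : 0 < p i. Proof. by have [+ _] := hp; apply. Qed.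

Lemma ifs_size : (1 < m)%N.
Proof.
have m0 : (0 < m)%N.
  rewrite lt0n; apply/eqP => m0; have [_] := hp.
  rewrite big1 => [|i _]; first by move/eqP; rewrite eq_sym oner_eq0.
  by case: i => i Hi; exfalso; move: Hi; rewrite [X in (_ < X)%N]m0.
rewrite ltn_neqAle m0 andbT; apply/eqP => m1.
pose i := Ordinal m0.
have := ifs_last hifs (i := i); rewrite (ifs_first hifs)//= => /(_ m1).
by have := r1 i; lra.
Qed.

(** The images of the open unit interval are intervals that do not overlap, and
    their left end points are ordered: so they come in the order of the
    indices. *)
Lemma ifs_ordered (i j : 'I_m) : (i < j)%N -> ifs_map r d i 1 <= ifs_map r d j 0.
Proof.
move=> ij; rewrite /ifs_map mulr1 mulr0 add0r leNgt; apply/negP => lt_j.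
have ne : i != j by rewrite -val_eqE neq_ltn ij.
have dij := ifs_mono hifs ij.
have ri0 := r0 i; have rj0 := r0 j.
pose z := (d j + Num.min (r i + d i) (r j + d j)) / 2.
have zi : d j < z < Num.min (r i + d i) (r j + d j).
  have : d j < Num.min (r i + d i) (r j + d j) by rewrite lt_min lt_j/= ltrDr.
  by rewrite /z; lra.
move: zi; rewrite lt_min => /and3P[zj zi1 zj1].
have : ((ifs_map r d i @` `]0, 1[) `&` (ifs_map r d j @` `]0, 1[)) z.
  split.
  - exists ((z - d i) / r i); last by rewrite /ifs_map mulrC divfK ?gt_eqF// subrK.
    rewrite /= in_itv/= ltr_pdivlMr// ltr_pdivrMr// mul0r mul1r.
    by apply/andP; split; lra.
  - exists ((z - d j) / r j); last by rewrite /ifs_map mulrC divfK ?gt_eqF// subrK.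
    rewrite /= in_itv/= ltr_pdivlMr// ltr_pdivrMr// mul0r mul1r.
    by apply/andP; split; lra.
by rewrite hcosc.
Qed.

Lemma ifs_shift_ge0 i : 0 <= d i.
Proof.
have m0 : (0 < m)%N := ltnW ifs_size.
have [i0|i0] := posnP i; first by rewrite (ifs_first hifs i0).
by rewrite -(ifs_first hifs (i := Ordinal m0) erefl); exact: (ifs_mono hifs).
Qed.

Lemma ifs_end_le1 i : r i + d i <= 1.
Proof.
have mE : m.-1.+1 = m by rewrite prednK// (ltnW ifs_size).
have mP : (m.-1 < m)%N by rewrite mE.
pose l := Ordinal mP.
have dl : d l = 1 - r l by exact: (ifs_last hifs).
have [il|il] := ltnP i l.
  have := ifs_ordered il; rewrite /ifs_map mulr1 mulr0 add0r dl.
  by have := r0 l; lra.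
have -> : i = l by apply/val_inj/eqP; rewrite eqn_leq il andbT -ltnS /= mE.
by rewrite dl addrC subrK.
Qed.

Lemma ifs_map_01 i x : 0 <= x <= 1 -> 0 <= ifs_map r d i x <= 1.
Proof.
move=> /andP[x0 x1]; have := r0 i; have := ifs_shift_ge0 i.
have := ifs_end_le1 i; rewrite /ifs_map => ? ? ?.
by apply/andP; split; nra.
Qed.

Lemma ifs_map_preimage_itv i (b c : bool) x y :
  ifs_map r d i @^-1` [set` Interval (BSide b x) (BSide c y)] =
  [set` Interval (BSide b ((x - d i) / r i)) (BSide c ((y - d i) / r i))].
Proof.
apply/funext => z; apply/propext; rewrite /=.
suff -> : (ifs_map r d i z \in Interval (BSide b x) (BSide c y)) =
    (z \in Interval (BSide b ((x - d i) / r i)) (BSide c ((y - d i) / r i))) by [].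
by case: b; case: c; rewrite !in_itv/= /ifs_map
  ?(ler_pdivrMr, ltr_pdivrMr, ler_pdivlMr, ltr_pdivlMr)//
  ?(lerBlDr, lerBrDr, ltrBlDr, ltrBrDr) (mulrC z).
Qed.

Lemma measurable_ifs_map i : measurable_fun setT (ifs_map r d i).
Proof. by apply: measurable_funD => //; apply: measurable_funM. Qed.

Lemma measurable_ifs_preimage i (E : set (measurableTypeR R)) :
  measurable E -> measurable (ifs_map r d i @^-1` E).
Proof. by move=> mE; rewrite -[X in measurable X]setTI; exact: measurable_ifs_map. Qed.

Section SelfSimilarMeasure.
Context (mu : probability (measurableTypeR R) R).
Hypothesis hmu : is_self_similar_measure r d p mu.

Local Notation mass := (mass mu).
Implicit Types (x y z h t rho : R) (cs : seq R).

Lemma self_similar_massE (E : set R) : measurable E ->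
  mass E = \sum_(i < m) p i * mass (ifs_map r d i @^-1` E).
Proof.
move=> mE; apply/EFin_inj; rewrite -massE// hmu// -sumEFin.
apply: eq_bigr => i _; rewrite EFinM -massE//.
exact: measurable_ifs_preimage.
Qed.

Lemma self_similar_mass_ge i (E : set R) : measurable E ->
  p i * mass (ifs_map r d i @^-1` E) <= mass E.
Proof.
move=> mE; rewrite [leRHS]self_similar_massE// (bigD1 i)//= lerDl.
by apply: sumr_ge0 => j _; rewrite mulr_ge0 ?mass_ge0// ltW.
Qed.

(** Each map contracts the distance to [0, 1], so the mass at distance more than
    z is at most the mass at distance more than z / l ^ n, which tends to 0. *)
Lemma self_similar_mass_far (z : R) : 0 < z -> mass (~` `[- z, 1 + z]) = 0.
Proof.
move=> z0.
have [e e0 er] : exists2 e : R, 0 < e & forall i, e <= 1 - r i.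
  by apply: finite_pos_lower_bound => i; rewrite subr_gt0.
have m0 : (0 < m)%N := ltnW ifs_size.
pose l := 1 - e; have l1 : l < 1 by rewrite /l; lra.
have rl i : r i <= l by have := er i; rewrite /l; lra.
have l0 : 0 < l by apply: lt_le_trans (rl (Ordinal m0)).
have mI (a b : R) : measurable (~` `[a, b] : set R) by exact: measurableC.
have step (y : R) : 0 < y -> mass (~` `[- y, 1 + y]) <= mass (~` `[- (y / l), 1 + y / l]).
  move=> y0; rewrite [leLHS]self_similar_massE//.
  have [_ p1] := hp; rewrite -[leRHS]mul1r -[X in X * _]p1 mulr_suml ler_sum// => i _.
  rewrite ler_wpM2l ?(ltW (p0 i))//; apply: le_mass => //.
    by apply: measurable_ifs_preimage; exact: mI.
  move=> x /=; apply: contra_not; rewrite !in_itv/= => /andP[lx xl].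
  have := r0 i; have := r1 i; have := rl i; have := ifs_shift_ge0 i.
  have := ifs_end_le1 i; rewrite /ifs_map => h1 h2 h3 h4 h5.
  have h6 : r i * (y / l) <= y by rewrite mulrA ler_pdivrMr// mulrC ler_pM2l.
  by apply/andP; split; nra.
have iter n : mass (~` `[- z, 1 + z]) <= mass (~` `[- (z / l ^+ n), 1 + z / l ^+ n]).
  elim: n => [|n IH]; first by rewrite expr0 divr1.
  apply: le_trans IH _; apply: le_trans (step _ _) _.
    by rewrite divr_gt0// exprn_gt0.
  by rewrite exprSr invfM mulrA.
apply/eqP; rewrite eq_le mass_ge0 andbT leNgt; apply/negP => /(mass_tail mu)[K].
apply/negP; rewrite -leNgt.
have [|n nK] := @expr_beats_poly R l^-1 (`|K| / z) 0; first by rewrite invf_gt1.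
apply: le_trans (iter n) _; apply: le_mass => // x /=; apply: contra_not.
rewrite !in_itv/= -ler_norml => xK.
have : `|x| <= z / l ^+ n.
  rewrite (le_trans xK)// (le_trans (ler_norm _))//.
  by move: nK; rewrite mulr1 ler_pdivrMr// exprVn mulrC.
by rewrite ler_norml => /andP[? ?]; apply/andP; split; lra.
Qed.

Lemma self_similar_mass_01 : mass `[0, 1] = 1.
Proof.
have : mu (~` `[0, 1]) = 0%E.
  have -> : ~` `[0, 1] = \bigcup_n (~` `[- n.+1%:R^-1, 1 + n.+1%:R^-1] : set R).
    rewrite -setC_bigcap; congr (~` _); apply/seteqP; split=> x.
      rewrite /= in_itv/= => /andP[x0 x1] n _ /=; rewrite in_itv/=.
      have : (0 : R) < n.+1%:R^-1 by rewrite invr_gt0.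
      by move: (n.+1%:R^-1) => e e0; apply/andP; split; lra.
    move=> xP /=; rewrite in_itv/=.
    have bounds (e : R) : 0 < e -> - e <= x <= 1 + e.
      move=> e0; have := xP (Num.truncn e^-1) I; rewrite /= in_itv/=.
      have : (Num.truncn e^-1).+1%:R^-1 <= e.
        by rewrite -[leRHS]invrK lef_pV2 ?posrE ?invr_gt0// ltW// truncnS_gt.
      by move: (_.+1%:R^-1) => f fe /andP[? ?]; apply/andP; split; lra.
    by apply/andP; split; apply/ler_addgt0Pr => e /bounds/andP[? ?]; lra.
  apply/eqP; rewrite eq_le measure_ge0 andbT.
  pose F n : set (measurableTypeR R) := ~` `[- n.+1%:R^-1, 1 + n.+1%:R^-1].
  have mF n : measurable (F n) by exact: measurableC.
  have mU : measurable (\bigcup_n F n) by exact: bigcupT_measurable.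
  apply: le_trans (measure_sigma_subadditive_tail mu (N := 0) mF mU _) _.
    by move=> x [n _ Fx]; exists n.
  rewrite eseries0// => n _ _; have := massE mu (mF n).
  by rewrite self_similar_mass_far// invr_gt0.
rewrite probability_setC// => /eqP; rewrite sube_eq ?fin_num_measure//.
by rewrite add0e => /eqP; rewrite /mass => <-.
Qed.

Lemma self_similar_mass_meets (E : set R) : measurable E -> mass E != 0 ->
  exists2 x, E x & 0 <= x <= 1.
Proof.
move=> mE; apply: contra_neqP => noE; apply/eqP; rewrite eq_le mass_ge0 andbT.
have := @probability_setC _ _ _ mu `[0, 1] (measurable_itv _).
rewrite [X in (1 - X)%E]massE// self_similar_mass_01 subee// => out0.
rewrite (le_trans (le_mass _ mE (measurableC (measurable_itv `[0, 1])) _))//.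
  by move=> x Ex /=; rewrite in_itv/= => x01; apply: noE; exists x.
by rewrite -lee_fin -massE ?out0//; exact: measurableC.
Qed.

Local Notation ball_sum h rho cs :=
  (\sum_(c <- cs) mass `[c - rho, c + rho] `^ h).

(** Disjoint intervals of length at least 2: at most two of them can meet
    [0, 1]. *)
Lemma ball_sum_large h rho cs : 0 < h -> 1 <= rho ->
  pairwise (fun x y => 2 * rho < `|x - y|) cs -> ball_sum h rho cs <= 2.
Proof.
move=> h0 rho1 pw.
pose a c := mass `[c - rho, c + rho] != 0.
rewrite (bigID a)/= [X in _ + X]big1 ?addr0 => [|c]; last first.
  by rewrite negbK => /eqP ->; rewrite powR0 ?gt_eqF.
have := pairwise_filter a pw; have := filter_all a cs.
have le1 c : mass `[c - rho, c + rho] `^ h <= 1.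
  by apply: powR_le1; rewrite ?(ltW h0)// mass_ge0 mass_le1.
have meets c : a c -> - rho <= c <= 1 + rho.
  move=> /self_similar_mass_meets[]// x /=; rewrite in_itv/= => /andP[? ?] /andP[? ?].
  by apply/andP; split; lra.
rewrite -big_filter; case: [seq c <- cs | a c] => [|c [|c' [|c2 s]]] /=.
- by rewrite big_nil.
- by rewrite big_seq1 (le_trans (le1 c))// ler1n.
- by rewrite big_cons big_seq1 lerD.
- move=> /and4P[/meets/andP[? ?] /meets/andP[? ?] /meets/andP[? ?] _].
  move=> /andP[/and3P[d1 d2 _] /andP[/andP[d3 _] _]]; exfalso.
  by move: d1 d2 d3; rewrite !ltr_normr => /orP[?|?] /orP[?|?] /orP[?|?]; lra.
Qed.

(** Self-similarity and subadditivity of the h-th power turn a disjoint family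
    of intervals of half length rho into the m families of its preimages, of
    half lengths rho / r_i. Iterating this up to scale 1 costs a factor
    [pressure_sum r p h t] <= 1 in each round. *)
Lemma packing_moment_bound h t : 0 < h <= 1 -> 0 <= t ->
  pressure_sum r p h t <= 1 ->
  exists2 C, 0 < C & forall rho cs, 0 < rho <= 1 ->
    pairwise (fun x y => 2 * rho < `|x - y|) cs ->
    ball_sum h rho cs <= C * rho `^ (- t).
Proof.
move=> h01 t0 press; have /andP[h0 h1] := h01.
have [e e0 er] := finite_pos_lower_bound r0.
have [f f0 fr] : exists2 f : R, 0 < f & forall i, f <= 1 - r i.
  by apply: finite_pos_lower_bound => i; rewrite subr_gt0.
have m0 : (0 < m)%N := ltnW ifs_size.
pose l := 1 - f; have l1 : l < 1 by rewrite /l; lra.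
have rl i : r i <= l by have := fr i; rewrite /l; lra.
have l0 : 0 < l by apply: lt_le_trans (rl (Ordinal m0)).
exists (2 * e^-1 `^ t); first by rewrite mulr_gt0// powR_gt0// invr_gt0.
suff claim n rho cs : l ^+ n <= rho <= e^-1 ->
    pairwise (fun x y => 2 * rho < `|x - y|) cs ->
    ball_sum h rho cs <= 2 * e^-1 `^ t * rho `^ (- t).
  move=> rho cs /andP[rho0 rho1] pw.
  have [|n nP] := @expr_beats_poly R l^-1 rho^-1 0; first by rewrite invf_gt1.
  apply: (claim n) => //; apply/andP; split; last first.
    apply: le_trans rho1 _; rewrite invf_ge1//.
    by apply: le_trans (er (Ordinal m0)) _; exact/ltW.
  by move: nP; rewrite mulr1 exprVn lef_pV2 ?posrE ?exprn_gt0.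
elim: n rho cs => [|n IH] rho cs /andP[lrho rhoe] pw.
  rewrite expr0 in lrho; have rho0 : 0 < rho by apply: lt_le_trans lrho.
  apply: le_trans (ball_sum_large h0 lrho pw) _.
  rewrite -mulrA ler_peMr// powRN ler_pdivlMr ?powR_gt0// mul1r.
  by apply: le_powR_base => //; exact: ltW.
have rho0 : 0 < rho by apply: lt_le_trans lrho; rewrite exprn_gt0.
have [rho1|rho1] := leP 1 rho.
  apply: le_trans (ball_sum_large h0 rho1 pw) _.
  rewrite -mulrA ler_peMr// powRN ler_pdivlMr ?powR_gt0// mul1r.
  by apply: le_powR_base => //; exact: ltW.
have pull c i : ifs_map r d i @^-1` `[c - rho, c + rho] =
    `[(c - d i) / r i - rho / r i, (c - d i) / r i + rho / r i]%classic.
  rewrite ifs_map_preimage_itv -mulrBl -mulrDl.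
  by rewrite [c - rho - _]addrAC [c + rho - _]addrAC.
apply: (@le_trans _ _ (\sum_(i < m) p i `^ h *
    ball_sum h (rho / r i) [seq (c - d i) / r i | c <- cs])).
  under [leRHS]eq_bigr do rewrite big_map big_distrr/=.
  rewrite exchange_big/=; apply: ler_sum => c _.
  rewrite self_similar_massE//.
  apply: le_trans (powR_sum_subadditive _ h01 _) _ => [i|].
    by rewrite mulr_ge0 ?mass_ge0 ?ltW.
  by apply: ler_sum => i _; rewrite powRM ?mass_ge0 ?(ltW (p0 i))// pull.
have bound i : ball_sum h (rho / r i) [seq (c - d i) / r i | c <- cs] <=
    2 * e^-1 `^ t * (rho / r i) `^ (- t).
  apply: IH.
    rewrite ler_pdivlMr// ler_pdivrMr//; apply/andP; split.
      by apply: le_trans lrho; rewrite exprSr ler_wpM2l// exprn_ge0// ltW.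
    by rewrite (le_trans (ltW rho1))// mulrC ler_pdivlMr// mul1r.
  rewrite pairwise_map; apply: sub_pairwise pw => x y /=.
  rewrite -mulrBl opprB addrA subrK normrM (gtr0_norm (x := (r i)^-1)) ?invr_gt0//.
  by rewrite mulrA ltr_pM2r// invr_gt0.
apply: le_trans (ler_sum _ _) _.
  by move=> i _; apply: ler_wpM2l (bound i); exact: powR_ge0.
under eq_bigr => i _.
  rewrite powRM ?invr_ge0 ?(ltW rho0) ?(ltW (r0 i))//.
  rewrite -(powR_inv1 (ltW (r0 i))) -powRrM mulrNN mul1r.
  rewrite [X in _ * X]mulrA [X in _ * X]mulrC mulrA; over.
rewrite -big_distrl/= -/(pressure_sum r p h t).
by rewrite ler_piMl// mulr_ge0 ?powR_ge0// mulr_ge0// powR_ge0.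
Qed.

End SelfSimilarMeasure.
End IteratedFunctionSystem.

(** * Homogeneous separated subsystems *)

Section WordCount.
Context {R : realType} {m : nat}.

(** The words of length n with the same number of occurrences of each letter
    have the same product of weights, and there are at most (n + 1) ^ m such
    classes: so one class carries at least the fraction 1 / (n + 1) ^ m of a sum
    that grows geometrically. *)
Lemma large_type_class (r p : 'I_m -> R) h t K :
  (forall i, 0 < r i) -> (forall i, 0 < p i) -> 1 < pressure_sum r p h t ->
  exists n, exists P : pred {ffun 'I_n -> 'I_m}, exists rho pi : R,
    [/\ 0 < rho, 0 < pi,
        forall v, P v -> \prod_k r (v k) = rho /\ \prod_k p (v k) = pi
      & K <= #|P|%:R * pi `^ h * rho `^ t].
Proof.
move=> r0 p0 press.
have [n nK] := expr_beats_poly (Num.max K 1) m press.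
pose occ (v : {ffun 'I_n -> 'I_m}) : {ffun 'I_m -> 'I_n.+1} :=
  [ffun i => inord #|[pred k | v k == i]|].
have prodE (f : 'I_m -> R) (v : {ffun 'I_n -> 'I_m}) : \prod_k f (v k) = \prod_i f i ^+ occ v i.
  rewrite (partition_big v predT)//=; apply: eq_bigr => i _.
  rewrite (eq_bigr (fun=> f i)) => [|k /eqP->//].
  rewrite prodr_const ffunE inordK// ltnS -[leqRHS]card_ord.
  exact: max_card.
pose w (v : {ffun 'I_n -> 'I_m}) : R :=
  (\prod_k p (v k)) `^ h * (\prod_k r (v k)) `^ t.
pose N : R := n.+1%:R ^+ m; have N0 : 0 < N by rewrite exprn_gt0.
have [c cP] : exists c, pressure_sum r p h t ^+ n / N <= \sum_(v | occ v == c) w v.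
  apply/existsP; apply: contraT; rewrite negb_exists => /forallP small.
  have total : pressure_sum r p h t ^+ n = \sum_c \sum_(v | occ v == c) w v.
    transitivity (\sum_v w v); last by rewrite (partition_big occ predT).
    rewrite -[X in _ ^+ X](card_ord n) -prodr_const bigA_distr_bigA/=; apply: eq_bigr => v _.
    by rewrite /w big_split/= !powR_prod// => i; exact: ltW.
  have cardN : #|{ffun 'I_m -> 'I_n.+1}|%:R = N by rewrite card_ffun !card_ord natrX.
  have : \sum_c \sum_(v | occ v == c) w v < \sum_(c : {ffun 'I_m -> 'I_n.+1})
      pressure_sum r p h t ^+ n / N.
    apply: ltr_sum => [|c _]; last by rewrite ltNge small.
    by apply/hasP; exists [ffun=> ord0]; rewrite ?mem_index_enum.
  by rewrite -total sumr_const -mulr_natl cardN mulrC divfK ?gt_eqF// ltxx.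
have [v0 v0o] : exists v, occ v == c.
  apply/existsP; apply: contraTT cP; rewrite negb_exists => /forallP none.
  rewrite big_pred0 => [|v]; last exact/negbTE/none.
  by rewrite -ltNge divr_gt0// exprn_gt0// (lt_trans ltr01).
exists n, (fun v => occ v == c), (\prod_k r (v0 k)), (\prod_k p (v0 k)).
have same (f : 'I_m -> R) v : occ v == c -> \prod_k f (v k) = \prod_k f (v0 k).
  by move=> /eqP vo; rewrite !prodE vo (eqP v0o).
split; [exact: prodr_gt0|exact: prodr_gt0|by move=> v vo; split; exact: same|].
have : Num.max K 1 <= pressure_sum r p h t ^+ n / N by rewrite ler_pdivlMr.
rewrite ge_max => /andP[Kle _]; apply: le_trans Kle _; apply: le_trans cP _.
rewrite (eq_bigr (fun=> w v0)) => [|v vo]; last by rewrite /w !(same _ v vo).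
by rewrite -mulrA -/(w v0) mulr_natl -(sumr_const (fun v => occ v == c)).
Qed.

End WordCount.

(** The maps are x |-> rho x + e_j with one common ratio rho, and the measure
    dominates pi times each of its images. Two different images of [0, 1] are a
    distance apart, and mu charges the gap between them: this is what keeps the
    points of different cylinders apart both in [0, 1] and in the time scale of
    the Brownian motion. *)
Record subsystem {R : realType} (mu : probability (measurableTypeR R) R) :=
  Subsystem {
    sub_index : finType ;
    sub_ratio : R ;
    sub_weight : R ;
    sub_shift : sub_index -> R ;
    sub_gap : R ;
    sub_gap_mass : R ;
    subsystem_map := fun (j : sub_index) (x : R) => sub_ratio * x + sub_shift j ;
    sub_ratio01 : 0 < sub_ratio < 1 ;
    sub_weight_gt0 : 0 < sub_weight ;
    sub_gap_gt0 : 0 < sub_gap ;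
    sub_gap_mass_gt0 : 0 < sub_gap_mass ;
    sub_map01 : forall j x, 0 <= x <= 1 -> 0 <= subsystem_map j x <= 1 ;
    sub_map_mass : forall j (E : set R), measurable E ->
      sub_weight * mass mu (subsystem_map j @^-1` E) <= mass mu E ;
    sub_map_apart : forall i j x y, i != j -> 0 <= x <= 1 -> 0 <= y <= 1 ->
      sub_gap <= `|subsystem_map i x - subsystem_map j y| /\
      sub_gap_mass <= `|mass_from0 mu (subsystem_map i x) - mass_from0 mu (subsystem_map j y)|
  }.

Section Words.
Context {R : realType} {m : nat} (r d p : 'I_m -> R).
Hypotheses (hifs : is_ifs r d) (hcosc : convex_open_set_condition r d).
Hypothesis hp : is_prob_vector p.
Context (mu : probability (measurableTypeR R) R).
Hypothesis hmu : is_self_similar_measure r d p mu.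
Implicit Types (x y h t : R) (u v : seq 'I_m).

Let r0 i : 0 < r i. Proof. by have /andP[] := ifs_ratio hifs i. Qed.
Let r1 i : r i < 1. Proof. by have /andP[] := ifs_ratio hifs i. Qed.
Let p0 i : 0 < p i. Proof. by have [+ _] := hp; apply. Qed.

Definition word_map u x := foldr (ifs_map r d) x u.
Definition word_ratio u := \prod_(i <- u) r i.
Definition word_weight u := \prod_(i <- u) p i.

Lemma word_ratio_gt0 u : 0 < word_ratio u. Proof. exact: prodr_gt0. Qed.
Lemma word_weight_gt0 u : 0 < word_weight u. Proof. exact: prodr_gt0. Qed.

Lemma word_mapE u x : word_map u x = word_ratio u * x + word_map u 0.
Proof.
rewrite /word_ratio; elim: u => [|i u IH] /=.
  by rewrite big_nil mul1r addr0.
by rewrite big_cons IH /ifs_map mulrDr -mulrA addrA.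
Qed.

Lemma word_map01 u x : 0 <= x <= 1 -> 0 <= word_map u x <= 1.
Proof. by move=> x01; elim: u => //= i u IH; exact: (ifs_map_01 hifs hcosc hp). Qed.

Lemma ler_word_map u x y : (word_map u x <= word_map u y) = (x <= y).
Proof. by rewrite word_mapE (word_mapE u y) lerD2r ler_pM2l// word_ratio_gt0. Qed.

Lemma ltr_word_map u x y : (word_map u x < word_map u y) = (x < y).
Proof. by rewrite !ltNge ler_word_map. Qed.

Lemma measurable_word_preimage u (E : set (measurableTypeR R)) :
  measurable E -> measurable (word_map u @^-1` E).
Proof.
by elim: u E => //= i u IH E mE; exact: IH (measurable_ifs_preimage r d i mE).
Qed.

Lemma word_map_mass u (E : set R) : measurable E ->
  word_weight u * mass mu (word_map u @^-1` E) <= mass mu E.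
Proof.
rewrite /word_weight; elim: u E => [|i u IH] E mE; first by rewrite big_nil mul1r.
rewrite big_cons; have mE' := measurable_ifs_preimage r d i mE.
apply: le_trans _ (self_similar_mass_ge hp hmu i mE).
by rewrite -mulrA ler_wpM2l ?(ltW (p0 i))//; exact: IH.
Qed.

Lemma word_map_ordered u v : size u = size v -> u != v ->
  word_map u 1 <= word_map v 0 \/ word_map v 1 <= word_map u 0.
Proof.
elim: u v => [|i u IH] [|j v]//= [suv]; rewrite eqseq_cons negb_and.
have ends w : 0 <= word_map w 1 <= 1 /\ 0 <= word_map w 0 <= 1.
  by split; apply: word_map01; rewrite ?lexx ler01.
have sep (k l : 'I_m) w w' : (k < l)%N ->
    ifs_map r d k (word_map w 1) <= ifs_map r d l (word_map w' 0).
  move=> kl; apply: le_trans (le_trans (ifs_ordered hifs hcosc kl) _);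
    rewrite lerD2r ler_pM2l//.
    by have [/andP[]] := ends w.
  by have [_ /andP[]] := ends w'.
have [<-{j}|ij _] := eqVneq i j.
  by move=> /(IH _ suv)[] le_uv; [left|right]; rewrite lerD2r ler_pM2l.
by move: ij; rewrite -val_eqE neq_ltn => /orP[] lt_ij; [left|right]; exact: sep.
Qed.

(** Words are truncated on the right by appending the letter 0 twice, which
    leaves a proportion of each interval, of positive measure, between the image
    of the truncated word and the next interval. *)
Lemma word_gap (z : 'I_m) : val z = 0%N ->
  word_map [:: z; z] 1 < 1 /\ 0 < mass mu `]word_map [:: z; z] 1, 1].
Proof.
move=> z0; rewrite /= /ifs_map !(ifs_first hifs z0) !addr0 mulr1.
have rr : r z * r z < r z by rewrite gtr_pMr.
split; first exact: lt_trans rr (r1 z).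
pose i1 := Ordinal (ifs_size hifs hp).
have zi1 : (z < i1)%N by rewrite z0.
have le1 := ifs_ordered hifs hcosc zi1.
rewrite /ifs_map mulr1 mulr0 add0r (ifs_first hifs z0) addr0 in le1.
apply: lt_le_trans _ (self_similar_mass_ge hp hmu i1 (measurable_itv _)).
rewrite mulr_gt0//.
have mI : measurable (ifs_map r d i1 @^-1` `]r z * r z, 1]).
  exact: measurable_ifs_preimage (measurable_itv _).
apply: (@lt_le_trans _ _ (mass mu `[0, 1])).
  by rewrite (self_similar_mass_01 hifs hcosc hp hmu) ltr01.
apply: le_mass => // x /=; rewrite !in_itv/= => x01.
have /andP[_ ->] := ifs_map_01 hifs hcosc hp i1 x01; rewrite andbT.
apply: lt_le_trans rr _; apply: le_trans le1 _.
by have /andP[x0 _] := x01; rewrite /ifs_map lerDr mulr_ge0// ltW.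
Qed.

(** Below the zero of the pressure function there is a subsystem whose own
    pressure is still at least 1: take the words of a large type class, and
    truncate them. *)
Lemma exists_subsystem h t : 1 < pressure_sum r p h t ->
  exists S : subsystem mu,
    1 <= #|sub_index S|%:R * sub_weight S `^ h * sub_ratio S `^ t.
Proof.
move=> press; have m0 : (0 < m)%N := ltnW (ifs_size hifs hp).
pose z : 'I_m := Ordinal m0.
have [z1 massz] := word_gap (erefl : val z = 0%N).
pose c := [:: z; z]; pose q := word_map c 1.
have [n [P [rho [pi [rho0 pi0 same large]]]]] :=
  large_type_class (word_weight c `^ h * word_ratio c `^ t)^-1 r0 p0 press.
pose J : finType := {v | P v}.
pose word (j : J) : seq 'I_m := codom (val j).
have ratioE j : word_ratio (word j) = rho.
  by have [<- _] := same _ (valP j); rewrite /word_ratio big_map big_enum.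
have weightE j : word_weight (word j) = pi.
  by have [_ <-] := same _ (valP j); rewrite /word_weight big_map big_enum.
have catE j x : word_map (word j ++ c) x = word_map (word j) (word_map c x).
  by rewrite /word_map foldr_cat.
have mapE j x : word_map (word j ++ c) x =
    rho * word_ratio c * x + word_map (word j ++ c) 0.
  by rewrite word_mapE {1}/word_ratio big_cat/= -/(word_ratio _) ratioE.
pose e j := word_map (word j ++ c) 0.
have apart i j x y : word_map (word i) 1 <= word_map (word j) 0 ->
    0 <= x <= 1 -> 0 <= y <= 1 ->
    rho * (1 - q) <= word_map (word j ++ c) y - word_map (word i ++ c) x /\
    pi * mass mu `]q, 1] <= mass_from0 mu (word_map (word j ++ c) y) -
                            mass_from0 mu (word_map (word i ++ c) x).
  move=> ij x01 y01.
  have xq : word_map (word i ++ c) x <= word_map (word i) q.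
    by rewrite catE !ler_word_map; case/andP: x01.
  have y1 : word_map (word i) 1 <= word_map (word j ++ c) y.
    rewrite catE (le_trans ij)// ler_word_map.
    by have /andP[] := word_map01 c y01.
  split.
    have := word_mapE (word i) q; have := word_mapE (word i) 1.
    by rewrite ratioE; lra.
  rewrite mass_from0B; last 2 first.
  - by have /andP[] := word_map01 (word i ++ c) x01.
  - apply: le_trans xq _; apply: le_trans _ y1.
    by rewrite ler_word_map ltW.
  rewrite -(weightE i); apply: le_trans _ (word_map_mass (word i) (measurable_itv _)).
  rewrite ler_wpM2l ?(ltW (word_weight_gt0 _))//.
  apply: le_mass => //; first exact: measurable_word_preimage.
  move=> s /=; rewrite !in_itv/= => /andP[qs s1].
  rewrite (le_lt_trans xq) ?ltr_word_map//=.
  by apply: le_trans y1; rewrite ler_word_map.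
have rho_lt1 : 0 < rho * word_ratio c < 1.
  have [v Pv] : exists v : {ffun 'I_n -> 'I_m}, P v.
    apply/existsP; apply: contraTT large; rewrite negb_exists => /forallP none.
    rewrite eq_card0 => [|v]; last exact/negbTE/none.
    by rewrite !mul0r -ltNge invr_gt0 mulr_gt0// powR_gt0// (word_ratio_gt0, word_weight_gt0).
  have rho1 : rho <= 1.
    by rewrite -(same v Pv).1 prodr_ile1// => k _; rewrite !ltW.
  rewrite mulr_gt0 ?word_ratio_gt0//= /word_ratio !big_cons big_nil mulr1.
  apply: le_lt_trans (ler_piMl _ rho1) _; first by rewrite mulr_ge0 ?ltW.
  by rewrite mulr_ilt1 ?ltW.
have pi_gt0 : 0 < pi * word_weight c by rewrite mulr_gt0 ?word_weight_gt0.
have gap0 : 0 < rho * (1 - q) by rewrite mulr_gt0// subr_gt0.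
have gapm0 : 0 < pi * mass mu `]q, 1] by rewrite mulr_gt0.
have S01 j x : 0 <= x <= 1 -> 0 <= rho * word_ratio c * x + e j <= 1.
  by move=> x01; rewrite -mapE; exact: word_map01.
have S_mass j (E : set R) : measurable E ->
    pi * word_weight c * mass mu ((fun x => rho * word_ratio c * x + e j) @^-1` E)
      <= mass mu E.
  move=> mE; have := word_map_mass (word j ++ c) mE.
  rewrite {1}/word_weight big_cat/= -/(word_weight _) weightE.
  by rewrite (_ : word_map _ = fun x => rho * word_ratio c * x + e j)//; apply/funext.
have word_inj : injective word.
  by move=> i j /eq_in_map ij; apply/val_inj/ffunP => k; apply: ij; rewrite mem_enum.
have S_apart (i j : J) x y : i != j -> 0 <= x <= 1 -> 0 <= y <= 1 ->
    rho * (1 - q) <= `|rho * word_ratio c * x + e i - (rho * word_ratio c * y + e j)| /\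
    pi * mass mu `]q, 1] <= `|mass_from0 mu (rho * word_ratio c * x + e i) -
                              mass_from0 mu (rho * word_ratio c * y + e j)|.
  move=> ij x01 y01; rewrite -!mapE.
  have [||le_ij|le_ji] := @word_map_ordered (word i) (word j).
  - by rewrite !size_codom.
  - by apply: contra_neq ij => /word_inj.
  - have [D M] := apart _ _ _ _ le_ij x01 y01.
    by rewrite distrC [X in _ /\ _ <= X]distrC; split; apply: le_trans (ler_norm _).
  - have [D M] := apart _ _ _ _ le_ji y01 x01.
    by split; apply: le_trans (ler_norm _).
exists (@Subsystem R mu J (rho * word_ratio c) (pi * word_weight c) e
  (rho * (1 - q)) (pi * mass mu `]q, 1]) rho_lt1 pi_gt0 gap0 gapm0 S01 S_mass S_apart).
rewrite /= card_sig !powRM ?(ltW rho0, ltW pi0, ltW (word_ratio_gt0 _), ltW (word_weight_gt0 _))//.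
have cc : 0 < word_weight c `^ h * word_ratio c `^ t.
  by rewrite mulr_gt0// powR_gt0// (word_ratio_gt0, word_weight_gt0).
move: large; rewrite -[X in X <= _ -> _]mul1r ler_pdivrMr// => /le_trans; apply.
by rewrite le_eqVlt; apply/orP; left; apply/eqP; ring.
Qed.

End Words.

(** * Cylinders of a subsystem *)

Section Cylinders.
Context {R : realType} (mu : probability (measurableTypeR R) R).
Context (S : subsystem mu).
Local Notation J := (sub_index S).
Local Notation rho := (sub_ratio S).
Local Notation pi := (sub_weight S).
Local Notation V := (mass_from0 mu).
Implicit Types (u v : seq J) (x y : R).

Let rho0 : 0 < rho. Proof. by have /andP[] := sub_ratio01 S. Qed.
Let rho1 : rho < 1. Proof. by have /andP[] := sub_ratio01 S. Qed.
Let pi0 : 0 < pi. Proof. exact: sub_weight_gt0. Qed.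

Definition cylinder u x : R := foldr (@subsystem_map R mu S) x u.

Lemma cylinderE u x : cylinder u x = rho ^+ size u * x + cylinder u 0.
Proof.
elim: u => [|j u IH] /=; first by rewrite expr0 mul1r addr0.
by rewrite IH /subsystem_map exprS mulrDr -!mulrA addrA.
Qed.

Lemma cylinder01 u x : 0 <= x <= 1 -> 0 <= cylinder u x <= 1.
Proof. by move=> x01; elim: u => //= j u IH; exact: sub_map01. Qed.

Lemma measurable_cylinder u : measurable_fun setT (cylinder u).
Proof.
rewrite (_ : cylinder u = fun x => rho ^+ size u * x + cylinder u 0).
  by apply: measurable_funD => //; apply: measurable_funM.
by apply/funext => x; exact: cylinderE.
Qed.

Lemma cylinder_mass u (E : set R) : measurable E ->
  pi ^+ size u * mass mu (cylinder u @^-1` E) <= mass mu E.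
Proof.
elim: u E => [|j u IH] E mE; first by rewrite expr0 mul1r.
have mE' : measurable (subsystem_map j @^-1` E).
  rewrite -[X in measurable X]setTI.
  exact: (measurable_cylinder [:: j] measurableT).
rewrite /= exprS -mulrA; apply: le_trans (ler_wpM2l (ltW pi0) (IH _ mE')) _.
exact: sub_map_mass.
Qed.

Lemma cylinder_mass_from0 u x y : 0 <= x <= 1 -> 0 <= y <= 1 ->
  pi ^+ size u * `|V x - V y| <= `|V (cylinder u x) - V (cylinder u y)|.
Proof.
have le_case (s t : R) : 0 <= s -> s <= t -> t <= 1 ->
    pi ^+ size u * `|V t - V s| <= `|V (cylinder u t) - V (cylinder u s)|.
  move=> s0 st t1.
  have ust : cylinder u s <= cylinder u t.
    by rewrite cylinderE (cylinderE u t) lerD2r ler_pM2l// exprn_gt0.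
  rewrite !ger0_norm ?subr_ge0 ?mass_from0_le// !mass_from0B//; last first.
    have s01 : 0 <= s <= 1 by rewrite s0 (le_trans st).
    by have /andP[] := cylinder01 u s01.
  apply: le_trans _ (cylinder_mass u (measurable_itv _)).
  rewrite ler_wpM2l ?exprn_ge0 ?(ltW pi0)//; apply: le_mass => //.
    rewrite -[X in measurable X]setTI.
    exact: (measurable_cylinder u measurableT).
  move=> z /=; rewrite !in_itv/= !(cylinderE u z, cylinderE u s, cylinderE u t).
  by rewrite ltrD2r lerD2r ltr_pM2l ?ler_pM2l// exprn_gt0.
move=> /andP[x0 x1] /andP[y0 y1]; have [xy|yx] := leP x y.
  by rewrite [X in _ * X]distrC [X in _ <= X]distrC le_case.
by rewrite le_case// ltW.
Qed.

Fixpoint common_prefix u v : nat :=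
  match u, v with
  | i :: u', j :: v' => if i == j then (common_prefix u' v').+1 else 0%N
  | _, _ => 0%N
  end.

Lemma common_prefix_lt u v : size u = size v -> u != v -> (common_prefix u v < size u)%N.
Proof.
elim: u v => [|i u IH] [|j v]//= [suv]; rewrite eqseq_cons negb_and.
by have [_ /=|//] := eqVneq i j; exact: IH.
Qed.

Lemma cylinder_apart u v : size u = size v -> u != v ->
  sub_gap S * rho ^+ common_prefix u v <= `|cylinder u 0 - cylinder v 0| /\
  sub_gap_mass S * pi ^+ common_prefix u v <= `|V (cylinder u 0) - V (cylinder v 0)|.
Proof.
have c01 w : 0 <= cylinder w 0 <= 1 by apply: cylinder01; rewrite lexx ler01.
elim: u v => [|i u IH] [|j v]//= [suv]; rewrite eqseq_cons negb_and.
have [<-{j} /=|ij _] := eqVneq i j; last by rewrite !expr0 !mulr1; exact: sub_map_apart.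
move=> /(IH _ suv)[D M]; split.
  rewrite /subsystem_map opprD addrACA subrr addr0 -mulrBr normrM (gtr0_norm rho0).
  by rewrite exprS mulrCA ler_pM2l.
have := @cylinder_mass_from0 [:: i] _ _ (c01 u) (c01 v).
by rewrite /= expr1 exprS mulrCA; apply: le_trans; rewrite ler_pM2l.
Qed.

Fixpoint words n : seq (seq J) :=
  if n is n'.+1 then [seq j :: u | j <- enum J, u <- words n'] else [:: [::]].

Lemma size_words n : size (words n) = (#|J| ^ n)%N.
Proof. by elim: n => //= n IH; rewrite size_allpairs IH expnS cardE. Qed.

Lemma word_size n u : u \in words n -> size u = n.
Proof.
elim: n u => [|n IH] u /=; first by rewrite inE => /eqP->.
by move=> /allpairsP[[j v] /= [_ /IH <- ->]].
Qed.

Lemma words_uniq n : uniq (words n).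
Proof.
elim: n => //= n IH; apply: allpairs_uniq => //; first exact: enum_uniq.
by move=> [i u] [j v] _ _ /= [-> ->].
Qed.

End Cylinders.

(** * The L^q spectrum *)

Section LqSpectrumValue.
Context {R : realType} (mu : probability (measurableTypeR R) R).
Implicit Types (q r t a : R).

(** The spectrum is an inferior limit of quotients by the negative number ln r: it
    is bounded from above by lower bounds for the packing sums along one sequence
    of radii tending to 0, and from below by upper bounds at all radii. *)
Lemma lq_spectrum_of_power_law q s :
  (forall t, s < t -> exists2 C : R, 0 < C & forall r, 0 < r <= 1 ->
     (packing_sum mu q r <= (C * r `^ (- t))%:E)%E) ->
  (forall t, t < s -> exists2 c : R, 0 < c & forall e : R, 0 < e ->
     exists2 r, 0 < r < e & ((c * r `^ (- t))%:E <= packing_sum mu q r)%E) ->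
  lq_spectrum mu q = (- s)%:E.
Proof.
move=> upper lower.
have sum_ge0 r : (0 <= packing_sum mu q r)%E.
  apply: ereal_sup_ubound; exists set0; last by rewrite esum_set0.
  by split=> //; exact: trivIset_set0.
have lneK C r t : 0 < C -> 0 < r -> lne (C * r `^ (- t))%:E = (ln C - t * ln r)%:E.
  move=> C0 r0; rewrite lne_EFin ?mulr_gt0 ?powR_gt0//.
  by rewrite lnM ?posrE ?powR_gt0// ln_powR mulNr.
have lne_mono (x y : \bar R) : (0 <= x)%E -> (0 <= y)%E -> (lne x <= lne y)%E = (x <= y)%E.
  by move=> x0 y0; rewrite lee_lne// in_itv/= ?x0 ?y0 leey.
have scale (a : R) (x y : \bar R) : a < 0 -> (0 <= x)%E -> (x <= y)%E ->
    (a%:E * lne y <= a%:E * lne x)%E.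
  move=> a0 x0 xy; rewrite -leeN2 -!mulNe -EFinN.
  apply: lee_wpmul2l; first by rewrite lee_fin oppr_ge0 ltW.
  by rewrite lne_mono// (le_trans x0).
(* an additive constant in the logarithm is absorbed by the margin e once the
   radius is small *)
have absorb (C e : R) : 0 < e -> exists2 d : R, 0 < d <= 1 & forall r,
    0 < r < d -> ln r < 0 /\ `|C| <= e * - ln r.
  move=> e0; exists (expR (- (`|C| / e))).
    by rewrite expR_gt0 expR_le1 oppr_le0 divr_ge0// ltW.
  move=> r /andP[r0 rd]; have lr : ln r < - (`|C| / e).
    by rewrite -ltr_expR lnK.
  have C0 : 0 <= `|C| / e by rewrite divr_ge0// ltW.
  split; first by lra.
  by rewrite mulrC -ler_pdivrMr//; lra.
apply/eqP; rewrite eq_le; apply/andP; split.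
- rewrite /lq_spectrum limf_einfE; apply: ge_ereal_sup => _ [V V0 <-].
  apply/lee_addgt0Pr => e e0.
  have [|c c0 cP] := lower (s - e / 2); first by rewrite ltrBlDr ltrDl divr_gt0.
  have [|d /andP[d0 d1] dP] := absorb (ln c) (e / 2); first by rewrite divr_gt0.
  have [f /= f0 fV] : exists2 f : R, 0 < f & forall r, 0 < r < f -> V r.
    move/nbhs_ballP: V0 => [f /= f0 fV]; exists f => // r /andP[r0 rf].
    by apply: fV => //=; rewrite /ball/= sub0r normrN gtr0_norm.
  have [|r /andP[r0 rm] rP] := cP (Num.min d f); first by rewrite lt_min d0.
  move: rm; rewrite lt_min => /andP[rd rf].
  have [|lr0 lrC] := dP r; first by rewrite r0.
  apply: (@le_trans _ _ ((ln r)^-1%:E * lne (packing_sum mu q r))%E).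
    by apply: ereal_inf_lbound; exists r => //; apply: fV; rewrite r0.
  apply: (@le_trans _ _ ((ln r)^-1%:E * lne (c * r `^ (- (s - e / 2)))%:E)%E).
    apply: scale; rewrite ?invr_lt0// lee_fin.
    by rewrite mulr_ge0 ?powR_ge0// ltW.
  rewrite lneK// -EFinM -EFinD lee_fin ler_ndivrMl//.
  by move: lrC; rewrite ler_norml => /andP[? ?]; lra.
- rewrite /lq_spectrum limf_einfE; apply/lee_addgt0Pr => e e0.
  have [|C C0 CP] := upper (s + e / 2); first by rewrite ltrDl divr_gt0.
  have [|d /andP[d0 d1] dP] := absorb (ln C) (e / 2); first by rewrite divr_gt0.
  rewrite -leeBlDr//.
  apply: (@le_trans _ _ (ereal_inf [set ((ln r)^-1%:E * lne (packing_sum mu q r))%E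
      | r in [set r : R | 0 < r < d]])); last first.
    apply: ereal_sup_ubound; exists [set r : R | 0 < r < d] => //.
    apply/nbhs_ballP; exists d => //= r; rewrite /ball/= sub0r normrN => rd r0.
    by rewrite r0 (le_lt_trans (ler_norm _)).
  apply: le_ereal_inf_tmp => _ [r /andP[r0 rd] <-].
  have [|lr0 lrC] := dP r; first by rewrite r0.
  apply: (@le_trans _ _ ((ln r)^-1%:E * lne (C * r `^ (- (s + e / 2)))%:E)%E); last first.
    apply: scale; rewrite ?invr_lt0//.
    by rewrite CP// r0 ltW// (lt_le_trans rd).
  rewrite lneK// -EFinM -EFinB lee_fin ler_ndivlMl//.
  by move: lrC; rewrite ler_norml => /andP[? ?]; lra.
Qed.

End LqSpectrumValue.

Section LqSpectrumOfSelfSimilar.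
Context {R : realType} {m : nat} (r d p : 'I_m -> R).
Hypotheses (hifs : is_ifs r d) (hcosc : convex_open_set_condition r d).
Hypothesis hp : is_prob_vector p.
Context (mu : probability (measurableTypeR R) R).
Hypothesis hmu : is_self_similar_measure r d p mu.
Implicit Types (h t e rho x : R).

Let r01 i : 0 < r i < 1. Proof. exact: ifs_ratio hifs i. Qed.
Let p0 i : 0 < p i. Proof. by have [+ _] := hp; apply. Qed.

Lemma packing_sum_upper h t : 0 < h <= 1 -> 0 <= t -> pressure_sum r p h t <= 1 ->
  exists2 C : R, 0 < C & forall rho, 0 < rho <= 1 ->
    (packing_sum mu h rho <= (C * rho `^ (- t))%:E)%E.
Proof.
move=> h01 t0 press.
have [C C0 CP] := packing_moment_bound hifs hcosc hp hmu h01 t0 press.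
exists C => // rho rho01; have /andP[rho0 _] := rho01.
apply: ge_ereal_sup => _ [F [centered disj] <-].
apply: ge_ereal_sup => _ [A [/finite_seqP[X0 AX] AF] <-].
pose X := undup X0; have XU : uniq X by exact: undup_uniq.
have {}AX : A = [set` X] by rewrite AX; apply/seteqP; split=> B /=; rewrite mem_undup.
rewrite {A}AX in AF *; rewrite -fsbig_seq//=.
have ball_itv (B : set R) : exists c, F B -> B = `[c - rho, c + rho]%classic.
  have [FB|nFB] := pselect (F B); last by exists 0.
  by have [x _ ->] := centered B FB; exists x; rewrite closed_ball_itv.
have [ctr ctrP] := choice ball_itv.
have in_ball B x : F B -> `|x - ctr B| <= rho -> B x.
  move=> FB; rewrite ler_norml => /andP[? ?]; rewrite [B in B x](ctrP B FB).
  by rewrite /= in_itv/=; apply/andP; split; lra.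
have massball B : B \in X ->
    (mu B `^ h)%E = (mass mu `[ctr B - rho, ctr B + rho] `^ h)%:E.
  by move=> BX; rewrite {1}(ctrP B (AF _ BX)) massE// poweR_EFin.
rewrite big_seq (eq_bigr _ massball).
rewrite sumEFin lee_fin -big_seq -(big_map ctr xpredT
  (fun c => mass mu `[c - rho, c + rho] `^ h)); apply: CP => //.
rewrite pairwise_map.
apply: (@sub_in_pairwise _ [in X] [rel x y | x != y]); last 2 first.
- exact/allP.
- by rewrite -uniq_pairwise.
move=> B B' BX BX' /= neB; rewrite ltNge; apply/negP => close.
have FB := AF _ BX; have FB' := AF _ BX'.
(* the midpoint of two close centers would lie in both balls *)
suff /(disj B B' FB FB')/eqP : B `&` B' !=set0 by rewrite (negbTE neB).
exists ((ctr B + ctr B') / 2); move: close; rewrite ler_norml => /andP[? ?].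
by split; apply: in_ball => //; rewrite ler_norml; apply/andP; split; lra.
Qed.

Lemma zero_in_support : measure_support mu 0.
Proof.
move=> e e0; have m0 : (0 < m)%N := ltnW (ifs_size hifs hp).
pose z : 'I_m := Ordinal m0; have /andP[rz0 rz1] := r01 z.
have [|n nP] := @expr_beats_poly R (r z)^-1 (2 / e) 0; first by rewrite invf_gt1.
pose u := nseq n z.
have ratioE : word_ratio r u = r z ^+ n by rewrite /word_ratio big_nseq iter_mulr_1.
have fix0 : word_map r d u 0 = 0.
  rewrite /u; elim: n {nP u ratioE} => //= n ->.
  by rewrite /ifs_map mulr0 add0r (ifs_first hifs).
rewrite massE ?lte_fin; last exact: measurable_ball.
apply: lt_le_trans _ (word_map_mass hp hmu u (measurable_ball 0 e)).
rewrite mulr_gt0 ?word_weight_gt0//.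
apply: (@lt_le_trans _ _ (mass mu `[0, 1])).
  by rewrite (self_similar_mass_01 hifs hcosc hp hmu) ltr01.
apply: le_mass => //; first exact: measurable_word_preimage (measurable_ball _ _).
move=> x /=; rewrite in_itv/= word_mapE ratioE fix0 addr0 => /andP[x0 x1].
have rn0 : 0 < r z ^+ n by rewrite exprn_gt0.
rewrite /ball/= sub0r normrN ger0_norm ?mulr_ge0 ?(ltW rn0)//.
apply: le_lt_trans (ler_piMr (ltW rn0) x1) _.
move: nP; rewrite mulr1 exprVn ler_pdivrMr// ler_pdivlMl//; lra.
Qed.

(** The balls around the images of 0 under the words of length n of a subsystem,
    of radius comparable to the length of its cylinders, are disjoint, and each
    of them carries the mass of its cylinder up to a constant. *)
Lemma packing_sum_lower (S : subsystem mu) h t : 0 <= h ->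
  1 <= #|sub_index S|%:R * sub_weight S `^ h * sub_ratio S `^ t ->
  exists2 c : R, 0 < c & forall e, 0 < e ->
    exists2 rho, 0 < rho < e & ((c * rho `^ (- t))%:E <= packing_sum mu h rho)%E.
Proof.
move=> h0 press; have /andP[rho0 rho1] := sub_ratio01 S.
set rho := sub_ratio S in press rho0 rho1; set pi := sub_weight S in press.
have pi0 : 0 < pi := sub_weight_gt0 S.
pose g := sub_gap S / 3; have g0 : 0 < g by rewrite divr_gt0// sub_gap_gt0.
pose b := mass mu `[- g, g].
have b0 : 0 < b.
  have := zero_in_support g0; rewrite massE ?lte_fin; last exact: measurable_ball.
  move=> /lt_le_trans; apply; apply: le_mass => //; first exact: measurable_ball.
  by move=> x; rewrite /ball/= sub0r normrN in_itv/= -ler_norml => /ltW.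
exists (b `^ h * g `^ t); first by rewrite mulr_gt0// powR_gt0.
move=> e e0.
have [|n nP] := @expr_beats_poly R rho^-1 (2 * g / e) 0; first by rewrite invf_gt1.
have rn0 : 0 < rho ^+ n by rewrite exprn_gt0.
pose q := g * rho ^+ n; have q0 : 0 < q by rewrite mulr_gt0.
exists q.
  move: nP; rewrite q0 mulr1 exprVn ler_pdivrMr// ler_pdivlMl// /q.
  by have : 0 < g * rho ^+ n by []; lra.
pose pt (u : seq (sub_index S)) := cylinder u 0.
pose F := [seq closed_ball (pt u) q | u <- words S n].
have ballE u : closed_ball (pt u) q = `[pt u - q, pt u + q]%classic.
  by rewrite closed_ball_itv.
have pre u : size u = n -> cylinder u @^-1` `[pt u - q, pt u + q] = `[- g, g]%classic.
  move=> un; apply/seteqP; split=> x /=; rewrite !in_itv/= cylinderE -/(pt u) un.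
    by rewrite /q => /andP[? ?]; rewrite -(ler_pM2r rn0) -[X in _ && X](ler_pM2r rn0);
       apply/andP; split; lra.
  by rewrite /q => /andP[? ?]; apply/andP; split; nra.
have ball_mass u : size u = n -> pi ^+ n * b <= mass mu (closed_ball (pt u) q).
  by move=> un; rewrite ballE /b -(pre u un) -[in pi ^+ _]un; exact: cylinder_mass.
have ball_support u : measure_support mu (pt u).
  move=> f f0; rewrite massE ?lte_fin; last exact: measurable_ball.
  apply: lt_le_trans _ (cylinder_mass u (measurable_ball (pt u) f)).
  rewrite mulr_gt0// ?exprn_gt0//.
  have := zero_in_support f0; rewrite massE ?lte_fin; last exact: measurable_ball.
  move=> /lt_le_trans; apply; apply: le_mass; first exact: measurable_ball.
    rewrite -[X in measurable X]setTI.
    by apply: (measurable_cylinder u measurableT); exact: measurable_ball.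
  move=> x; rewrite /ball/= sub0r normrN cylinderE -/(pt u) opprD addrCA subrr addr0.
  rewrite normrN normrM ger0_norm ?exprn_ge0 ?(ltW rho0)//.
  by apply: le_lt_trans; rewrite ler_piMl// exprn_ile1// ltW.
have apart u v : u \in words S n -> v \in words S n -> u != v -> 2 * q < `|pt u - pt v|.
  move=> /word_size un /word_size vn uv.
  have suv : size u = size v by rewrite un vn.
  have [D _] := cylinder_apart suv uv; apply: lt_le_trans D.
  apply: (@lt_le_trans _ _ (sub_gap S * rho ^+ n)).
    have : sub_gap S = 3 * g by rewrite /g mulrC divfK.
    by rewrite /q => ->; have : 0 < g * rho ^+ n by []; lra.
  rewrite ler_pM2l ?sub_gap_gt0// ler_wiXn2l ?(ltW rho0) ?(ltW rho1)//.
  by rewrite -un ltnW// common_prefix_lt.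
have disj u v : u \in words S n -> v \in words S n ->
    closed_ball (pt u) q `&` closed_ball (pt v) q !=set0 -> u = v.
  move=> uw vw [x []]; rewrite !ballE /= !in_itv/= => /andP[? ?] /andP[? ?].
  apply/eqP; apply: contraT => /(apart _ _ uw vw); rewrite ltr_normr => /orP[]; lra.
have F_packing : is_packing mu q [set` F].
  split=> [C /mapP[u _ ->]|]; first by exists (pt u).
  move=> C D /mapP[u uw ->] /mapP[v vw ->] /(disj u v uw vw) -> //.
have F_uniq : uniq F.
  rewrite map_inj_in_uniq ?words_uniq// => u v uw vw uv.
  apply: disj => //; rewrite uv setIid ballE; exists (pt v).
  by rewrite /= in_itv/=; apply/andP; split; lra.
apply: (@le_trans _ _ (\esum_(C in [set` F]) (mu C `^ h))%E); last first.
  by apply: ereal_sup_ubound; exists [set` F].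
apply: esum_ge; exists [set` F]; first by split=> //; exact: finite_seq.
rewrite -fsbig_seq// big_map big_seq.
apply: (@le_trans _ _ (\sum_(u <- words S n | u \in words S n) ((pi ^+ n * b) `^ h)%:E)%E); last first.
  apply: lee_sum => u /word_size un; rewrite ballE massE// poweR_EFin lee_fin -ballE.
  by apply: le_powR_base => //; rewrite ?ball_mass// mulr_ge0 ?exprn_ge0 ?ltW.
rewrite sumEFin lee_fin -big_seq big_const_seq count_predT iter_addr_0 size_words.
rewrite -mulr_natl natrX powRM ?exprn_ge0 ?(ltW pi0) ?(ltW b0)// powR_expr ?(ltW pi0)//.
rewrite powRN /q powRM ?(ltW g0) ?(ltW rn0)// powR_expr ?(ltW rho0)//.
have gt0 : 0 < g `^ t by rewrite powR_gt0.
have rt0 : 0 < rho `^ t by rewrite powR_gt0.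
rewrite invfM -mulrA mulVKf ?gt_eqF// -exprVn mulrA [X in _ <= X]mulrC.
rewrite ler_wpM2l ?powR_ge0// -exprMn lerXn2r ?nnegrE ?invr_ge0 ?(ltW rt0)//.
  by rewrite mulr_ge0 ?powR_ge0.
by rewrite -div1r ler_pdivrMr.
Qed.

Lemma lq_spectrum_self_similar h s : 0 < h <= 1 -> 0 < s ->
  pressure_sum r p h s = 1 -> lq_spectrum mu h = (- s)%:E.
Proof.
move=> h01 s0 press; have m0 : (0 < m)%N := ltnW (ifs_size hifs hp).
apply: lq_spectrum_of_power_law => t ts.
- apply: packing_sum_upper => //; first by rewrite ltW// (lt_trans s0).
  by rewrite -press ltW// pressure_sum_decreasing.
- have : 1 < pressure_sum r p h t by rewrite -press pressure_sum_decreasing.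
  move=> /(exists_subsystem hifs hcosc hp hmu)[S SP].
  by apply: (packing_sum_lower (S := S)) => //; have /andP[/ltW] := h01.
Qed.

End LqSpectrumOfSelfSimilar.

(** * Bounds on normal laws *)

Section NormalLaw.
Context {R : realType}.
Implicit Types (a v s : R).
Local Notation leb := (@lebesgue_measure R).

(** The density of N(0, v) is at most 1 / (2 sqrt v). *)
Lemma normal_law_small a v : 0 < v -> 0 <= a ->
  (normal_law 0 v [set x | (`|x| <= a)%R] <= (a / Num.sqrt v)%:E)%E.
Proof.
move=> v0 a0; rewrite /normal_law gt_eqF// /normal_prob; set s := Num.sqrt v.
have s0 : 0 < s by rewrite sqrtr_gt0.
have -> : [set x : R | `|x| <= a] = `[- a, a]%classic.
  by apply/seteqP; split=> x /=; rewrite in_itv/= -ler_norml.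
have peak : normal_peak s <= (2 * s)^-1.
  rewrite /normal_peak lef_pV2 ?posrE ?sqrtr_gt0 ?mulr_gt0//; last first.
    by rewrite -mulr_natr !mulr_gt0// ?exprn_gt0 ?pi_gt0.
  rewrite -[leLHS]ger0_norm ?mulr_ge0 ?(ltW s0)// -sqrtr_sqr ler_wsqrtr//.
  rewrite exprMn -mulr_natr; have := pi_ge2 R; have : 0 < s ^+ 2 by rewrite exprn_gt0.
  nra.
apply: (@le_trans _ _ (\int[leb]_(x in `[(- a)%R, a]) (2 * s)^-1%:E)%E).
  apply: ge0_le_integral => //.
  - by move=> x _; rewrite lee_fin normal_pdf_ge0.
  - by apply/measurable_EFinP; apply: measurable_funTS; exact: measurable_normal_pdf.
  - move=> x _; rewrite lee_fin (le_trans _ peak)//.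
    by apply: normal_pdf_ub; rewrite gt_eqF.
rewrite integral_cst//= lebesgue_measure_itv/= lte_fin.
have [aa|aa] := ltP (- a) a; last by rewrite mule0 lee_fin divr_ge0// ltW.
rewrite -EFinD -EFinM lee_fin invfM opprK.
have : 0 < s^-1 by rewrite invr_gt0.
lra.
Qed.

(** exp(-x^2 / 2v) is the product of exp(-x^2 / 4v), which is small outside
    [-a, a], and of a multiple of the density of N(0, 2v). *)
Lemma normal_law_tail a v : 0 < v -> 0 <= a ->
  (normal_law 0 v [set x | (a < `|x|)%R] <= (2 * expR (- (a ^+ 2 / (4 * v))))%:E)%E.
Proof.
move=> v0 a0; rewrite /normal_law gt_eqF// /normal_prob.
set s := Num.sqrt v; set s2 := Num.sqrt (2 * v).
have s0 : 0 < s by rewrite sqrtr_gt0.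
have s20 : 0 < s2 by rewrite sqrtr_gt0 mulr_gt0.
have mA : measurable [set x : R | a < `|x|].
  have -> : [set x : R | a < `|x|] = ~` `[- a, a]%classic.
    apply/seteqP; split=> x /=; rewrite in_itv/= -ler_norml; first by rewrite ltNge => /negP.
    by rewrite ltNge => /negP.
  exact: measurableC.
pose e := 2 * expR (- (a ^+ 2 / (4 * v))).
have e0 : 0 <= e by rewrite mulr_ge0// expR_ge0.
have sqs : s ^+ 2 = v by rewrite sqr_sqrtr// ltW.
have sqs2 : s2 ^+ 2 = 2 * v by rewrite sqr_sqrtr// mulr_ge0// ltW.
have peaks : normal_peak s <= 2 * normal_peak s2.
  rewrite /normal_peak sqs sqs2.
  set y := v * pi *+ 2; have y0 : 0 < y by rewrite /y -mulr_natr !mulr_gt0// pi_gt0.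
  have -> : 2 * v * pi *+ 2 = 2 * y by rewrite /y -mulrnAr -mulrA mulrnAr.
  rewrite sqrtrM// invfM mulrA ler_peMl ?invr_ge0 ?sqrtr_ge0//.
  rewrite ler_pdivlMr ?sqrtr_gt0// mul1r -[leRHS]ger0_norm// -sqrtr_sqr.
  by rewrite ler_wsqrtr//; lra.
have split_exp (x : R) : a < `|x| -> expR (- x ^+ 2 / (v *+ 2)) <=
    expR (- (a ^+ 2 / (4 * v))) * expR (- x ^+ 2 / (2 * v *+ 2)).
  move=> ax; rewrite -expRD ler_expR.
  have xa : a ^+ 2 <= x ^+ 2.
    by rewrite -[leRHS]real_normK ?num_real// lerXn2r ?nnegrE// ltW.
  have iv0 : 0 < v^-1 by rewrite invr_gt0.
  rewrite -(mulr_natr v) -(mulr_natr (2 * v)) !invfM !mulNr.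
  have := ler_wpM2r (ltW iv0) xa.
  by move: (x ^+ 2) (a ^+ 2) (v^-1) => X A W; lra.
apply: (@le_trans _ _ (\int[leb]_(x in [set x | (a < `|x|)%R]) (e * normal_pdf 0 s2 x)%:E)%E).
  apply: ge0_le_integral => //.
  - by move=> x _; rewrite lee_fin normal_pdf_ge0.
  - by apply/measurable_EFinP; apply: measurable_funTS; exact: measurable_normal_pdf.
  - apply/measurable_EFinP; apply: measurable_funTS; apply: measurable_funM => //.
    exact: measurable_normal_pdf.
  move=> x /= /split_exp ax; rewrite lee_fin !normal_pdfE ?gt_eqF//.
  rewrite /normal_fun sqs sqs2 !subr0 /e [leRHS]mulrACA.
  by apply: ler_pM; rewrite ?normal_peak_ge0 ?expR_ge0.
apply: (@le_trans _ _ (\int[leb]_x (e * normal_pdf 0 s2 x)%:E)%E).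
  apply: ge0_subset_integral => //.
  - apply/measurable_EFinP/measurable_funM => //; exact: measurable_normal_pdf.
  - by move=> x _; rewrite lee_fin mulr_ge0// normal_pdf_ge0.
under eq_integral do rewrite EFinM.
rewrite ge0_integralZl ?lee_fin//.
- by rewrite integral_normal_pdf mule1.
- by apply/measurable_EFinP; exact: measurable_normal_pdf.
- by move=> x _; rewrite lee_fin normal_pdf_ge0.
Qed.

End NormalLaw.

(** * Hoelder continuity of the paths *)

Lemma nat_between j k : (k <= j)%N -> (j < k.+2)%N -> j = k \/ j = k.+1.
Proof. lia. Qed.

Section DyadicChaining.
Context {R : realType}.
Implicit Types (f : R -> R) (h x y K : R).

Definition dyadic n (j : nat) : R := j%:R / 2 ^+ n.

Definition dyadic_floor n x : R := dyadic n (Num.truncn (2 ^+ n * x)).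

Lemma dyadic_floorP n x : 0 <= x ->
  dyadic_floor n x <= x < dyadic_floor n x + 2 ^- n.
Proof.
move=> x0; have n0 : (0 : R) < 2 ^+ n by rewrite exprn_gt0.
rewrite /dyadic_floor /dyadic -[X in _ < _ + X]mul1r -mulrDl.
rewrite ler_pdivrMr// ltr_pdivlMr// ![x * _]mulrC natr1.
by rewrite truncn_le ?mulr_ge0 ?(ltW n0)//= truncnS_gt.
Qed.

Lemma dyadic_floor_range n x : 0 <= x <= 1 ->
  (Num.truncn (2 ^+ n * x) <= 2 ^ n)%N.
Proof.
move=> /andP[x0 x1]; rewrite -(ler_nat R) natrX.
apply: le_trans (_ : 2 ^+ n * x <= _); last by rewrite ler_piMr.
by rewrite truncn_le mulr_ge0.
Qed.

(** Increments over neighbouring dyadic points, bounded by a geometric sequence,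
    add up along the dyadic approximations of two points of [0, 1]. *)
Lemma holder_of_dyadic f h K : 0 < h -> 0 <= K ->
  (forall x (e : R), 0 <= x <= 1 -> 0 < e -> exists2 d : R, 0 < d &
     forall y, 0 <= y <= 1 -> `|x - y| < d -> `|f x - f y| < e) ->
  (forall n j, (j < 2 ^ n)%N ->
     `|f (dyadic n j.+1) - f (dyadic n j)| <= K * (2 `^ (- h)) ^+ n) ->
  exists2 C : R, 0 <= C & forall x y, 0 <= x <= 1 -> 0 <= y <= 1 ->
    `|f x - f y| <= C * `|x - y| `^ h.
Proof.
move=> h0 K0 cont inc; set q := 2 `^ (- h).
have q0 : 0 < q by rewrite powR_gt0.
have q1 : q < 1 by rewrite /q /powR gt_eqF// expR_lt1 mulNr oppr_lt0 mulr_gt0// ln_gt0// ltr1n.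
have floor01 n x : 0 <= x <= 1 -> 0 <= dyadic_floor n x <= 1.
  move=> /andP[x0 x1]; have /andP[le_x _] := dyadic_floorP n x0.
  by rewrite (le_trans le_x x1) andbT divr_ge0// exprn_ge0.
have step n x : 0 <= x <= 1 ->
    `|f (dyadic_floor n.+1 x) - f (dyadic_floor n x)| <= K * q ^+ n.+1.
  move=> x01; have /andP[x0 x1] := x01.
  have n0 : (0 : R) < 2 ^+ n by rewrite exprn_gt0.
  pose k := Num.truncn (2 ^+ n * x); pose k' := Num.truncn (2 ^+ n.+1 * x).
  have /andP[kx xk] : k%:R <= 2 ^+ n * x < k.+1%:R.
    by rewrite -(truncn_eq k) ?eqxx// mulr_ge0// ltW.
  have /andP[kx' xk'] : k'%:R <= 2 ^+ n.+1 * x < k'.+1%:R.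
    by rewrite -(truncn_eq k') ?eqxx// mulr_ge0// exprn_ge0.
  have E : dyadic_floor n x = dyadic n.+1 k.*2.
    by rewrite /dyadic_floor /dyadic -/k -muln2 natrM exprS invfM mulrA mulfK.
  have [||kk'|kk'] := @nat_between k' k.*2.
  - rewrite -ltnS -(ltr_nat R); apply: le_lt_trans xk'.
    by rewrite exprS -mul2n natrM -mulrA ler_pM2l.
  - rewrite -doubleS -(ltr_nat R); apply: le_lt_trans kx' _.
    by rewrite exprS -mul2n natrM -mulrA ltr_pM2l.
  - by rewrite E /dyadic_floor -/k' kk' subrr normr0 mulr_ge0// exprn_ge0// ltW.
  - rewrite E /dyadic_floor -/k' kk'; apply: inc.
    by have := dyadic_floor_range n.+1 x01; rewrite -/k' kk'.
have chain n k x : 0 <= x <= 1 ->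
    `|f (dyadic_floor (n + k) x) - f (dyadic_floor n x)| <= K * q ^+ n * (1 - q)^-1.
  move=> x01; apply: (@le_trans _ _ (K * q ^+ n * \sum_(i < k) q ^+ i)); last first.
    rewrite ler_wpM2l ?mulr_ge0 ?exprn_ge0 ?(ltW q0)// geometric_sum_le//.
    by rewrite ltW.
  elim: k => [|k IH].
    by rewrite addn0 subrr normr0 big_ord0 mulr0.
  rewrite big_ord_recr/= mulrDr addnS.
  rewrite -(subrK (f (dyadic_floor (n + k) x)) (f (dyadic_floor (n + k).+1 x))) -addrA addrC.
  apply: le_trans (ler_normD _ _) _; apply: lerD IH _.
  apply: le_trans (step _ _ x01) _; rewrite -mulrA -exprD ler_wpM2l// exprS.
  by rewrite ler_piMl ?exprn_ge0 ?ltW.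
pose D := K * (1 - q)^-1.
have D0 : 0 <= D by rewrite mulr_ge0// invr_ge0 subr_ge0 ltW.
have limit n x : 0 <= x <= 1 -> `|f x - f (dyadic_floor n x)| <= D * q ^+ n.
  move=> x01; have /andP[x0 x1] := x01; apply/ler_addgt0Pr => e e0.
  have [d d0 dP] := cont x e x01 e0.
  have [|k kP] := @expr_beats_poly R 2 d^-1 0; first by rewrite ltr1n.
  have nk : `|x - dyadic_floor (n + k) x| < d.
    have /andP[lo hi] := dyadic_floorP (n + k) x0.
    rewrite ger0_norm ?subr_ge0// ltrBlDl (lt_le_trans hi)// lerD2l.
    rewrite -[leRHS]invrK lef_pV2 ?posrE ?invr_gt0 ?exprn_gt0//.
    rewrite mulr1 in kP; apply: le_trans kP _.
    by rewrite ler_weXn2l ?ler1n// leq_addl.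
  rewrite -(subrK (f (dyadic_floor (n + k) x)) (f x)) -addrA addrC.
  apply: le_trans (ler_normD _ _) _; apply: lerD.
    by apply: le_trans (chain n k x x01) _; rewrite /D mulrAC.
  by rewrite ltW// dP// floor01.
exists ((2 * D + K) * 2 `^ h).
  by rewrite mulr_ge0 ?powR_ge0// addr_ge0// mulr_ge0.
have ordered x y : 0 <= x <= 1 -> 0 <= y <= 1 -> x < y ->
    `|f x - f y| <= (2 * D + K) * 2 `^ h * `|x - y| `^ h.
  move=> x01 y01 xy; have /andP[x0 x1] := x01; have /andP[y0 y1] := y01.
  have d0 : 0 < y - x by rewrite subr_gt0.
  (* the first scale that separates x and y *)
  have : exists n, 2 ^- n.+1 < y - x.
    have [|k kP] := @expr_beats_poly R 2 (y - x)^-1 0; first by rewrite ltr1n.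
    exists k; rewrite -[ltRHS]invrK ltf_pV2 ?posrE ?invr_gt0 ?exprn_gt0//.
    rewrite mulr1 in kP; apply: le_lt_trans kP _.
    by rewrite exprS ltr_pMl ?exprn_gt0// ltr1n.
  move=> /ex_minnP[n nd nmin].
  have dn : y - x <= 2 ^- n.
    case: n nd nmin => [_ _|n nd nmin]; first by rewrite expr0 invr1; lra.
    by rewrite leNgt; apply/negP => /nmin; rewrite ltnn.
  pose k := Num.truncn (2 ^+ n * x); pose l := Num.truncn (2 ^+ n * y).
  have n0 : (0 : R) < 2 ^+ n by rewrite exprn_gt0.
  have /andP[kx xk] : k%:R <= 2 ^+ n * x < k.+1%:R.
    by rewrite -(truncn_eq k) ?eqxx// mulr_ge0// ltW.
  have /andP[ly yl] : l%:R <= 2 ^+ n * y < l.+1%:R.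
    by rewrite -(truncn_eq l) ?eqxx// mulr_ge0// ltW.
  have near : `|f (dyadic_floor n y) - f (dyadic_floor n x)| <= K * q ^+ n.
    have [||lk|lk] := @nat_between l k.
    - rewrite -ltnS -(ltr_nat R); apply: le_lt_trans yl.
      by rewrite (le_trans kx)// ler_pM2l// ltW.
    - rewrite -(ltr_nat R); apply: le_lt_trans ly _.
      rewrite -(natr1 k.+1) -[y](subrK x) mulrDr addrC ltr_leD//.
      by move: dn; rewrite -[2 ^- n]mul1r ler_pdivlMr// mulrC.
    - by rewrite /dyadic_floor -/k -/l lk subrr normr0 mulr_ge0// exprn_ge0// ltW.
    - rewrite /dyadic_floor -/k -/l lk; apply: inc.
      by have := dyadic_floor_range n y01; rewrite -/l lk.
  have qn : q ^+ n <= 2 `^ h * `|x - y| `^ h.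
    rewrite -powRM// distrC (gtr0_norm d0) /q -powR_mulrn ?powR_ge0// -powRrM.
    have -> : 2 `^ (- h * n%:R) = (2 ^- n) `^ h :> R.
      by rewrite -powR_invn// -powRrM !mulNr mulrC.
    apply: le_powR_base; rewrite ?(ltW h0) ?invr_ge0 ?(ltW n0)//.
    by move: nd; rewrite exprS invfM ltr_pdivrMl// => /ltW.
  have := limit n x x01; have := limit n y y01; move: near.
  set fx := f (dyadic_floor n x); set fy := f (dyadic_floor n y) => A B C.
  apply: (@le_trans _ _ ((2 * D + K) * q ^+ n)); last first.
    by rewrite -mulrA ler_wpM2l// addr_ge0// mulr_ge0.
  have -> : f x - f y = (f x - fx) + ((fx - fy) + (fy - f y)) by ring.
  apply: le_trans (ler_normD _ _) _.
  apply: le_trans (lerD C (ler_normD _ _)) _; rewrite distrC in A; rewrite distrC in B.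
  by rewrite !mulrDl; lra.
move=> x y x01 y01; have [xy|yx|->] := ltgtP x y; first exact: ordered.
  by rewrite distrC (distrC x) ordered.
by rewrite !subrr normr0 mulr_ge0 ?powR_ge0// mulr_ge0 ?powR_ge0// addr_ge0// mulr_ge0.
Qed.

End DyadicChaining.

Section BrownianPaths.
Context {R : realType} {disp : measure_display} {T : measurableType disp}.
Context (P : probability T R) (H : R) (B : R -> {RV P >-> R}).
Hypothesis hB : is_fbm H B.
Implicit Types (s t a h : R).

Lemma measurable_increment_set s t (A : set (measurableTypeR R)) : measurable A ->
  measurable ((fun w => B t w - B s w) @^-1` A).
Proof.
move=> mA; rewrite -[X in measurable X]setTI.
by apply: measurable_funB => //; exact: measurable_funP.
Qed.

Let measurable_abs_le a : measurable [set x : measurableTypeR R | `|x| <= a].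
Proof.
have -> : [set x : R | `|x| <= a] = `[- a, a]%classic.
  by apply/seteqP; split=> x /=; rewrite in_itv/= -ler_norml.
exact: measurable_itv.
Qed.

Lemma measurable_increment_le s t a : measurable [set w | `|B t w - B s w| <= a].
Proof. exact: (measurable_increment_set s t (measurable_abs_le a)). Qed.

Lemma measurable_increment_gt s t a : measurable [set w | a < `|B t w - B s w|].
Proof.
have -> : [set w | a < `|B t w - B s w|] = ~` [set w | `|B t w - B s w| <= a].
  by apply/seteqP; split=> w /=; rewrite ltNge => /negP.
by apply: measurableC; exact: measurable_increment_le.
Qed.

Lemma increment_small s t a : 0 <= s -> 0 <= t -> s != t -> 0 <= a ->
  (P [set w | (`|B t w - B s w| <= a)%R] <= (a / `|t - s| `^ H)%:E)%E.
Proof.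
move=> s0 t0 st a0; have d0 : 0 < `|t - s| by rewrite normr_gt0 subr_eq0 eq_sym.
have -> : `|t - s| `^ H = Num.sqrt (`|t - s| `^ (2 * H)).
  by rewrite -powR12_sqrt ?powR_ge0// -powRrM mulrAC divff ?mul1r.
have := fbm_increments hB s0 t0 (measurable_abs_le a).
by rewrite /preimage /= => ->; apply: normal_law_small => //; rewrite powR_gt0.
Qed.

Lemma increment_tail s t a : 0 <= s -> 0 <= t -> s != t -> 0 <= a ->
  (P [set w | (a < `|B t w - B s w|)%R] <=
    (2 * expR (- (a ^+ 2 / (4 * `|t - s| `^ (2 * H)))))%:E)%E.
Proof.
move=> s0 t0 st a0; have d0 : 0 < `|t - s| by rewrite normr_gt0 subr_eq0 eq_sym.
have mA : measurable [set x : measurableTypeR R | a < `|x|].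
  have -> : [set x : R | a < `|x|] = ~` [set x | `|x| <= a].
    by apply/seteqP; split=> x /=; rewrite ltNge => /negP.
  by apply: measurableC; exact: measurable_abs_le.
have := fbm_increments hB s0 t0 mA.
by rewrite /preimage /= => ->; apply: normal_law_tail => //; rewrite powR_gt0.
Qed.

Let bad h n : set T := \bigcup_(j < (2 ^ n)%N)
  [set w | (2 `^ (- h)) ^+ n < `|B (dyadic n j.+1) w - B (dyadic n j) w|].

Let measurable_bad h n : measurable (bad h n).
Proof. by apply: bigcup_measurable => j _; exact: measurable_increment_gt. Qed.

(** At level n there are 2 ^ n increments, each of which exceeds 2 ^ (- n h) with
    a probability that decreases faster than any power of 2 ^ (- n). *)
Let bad_small h : 0 < h < H -> exists2 C : R, 0 <= C & forall n,
  (P (bad h n) <= (C / (2 ^ n.+1)%:R)%:E)%E.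
Proof.
move=> /andP[h0 hH].
pose th : R := 4 `^ (H - h).
have th1 : 1 < th by rewrite /th /powR gt_eqF// expR_gt1 mulr_gt0 ?subr_gt0// ln_gt0// ltr1n.
have th0 : 0 < th := lt_trans ltr01 th1.
have [k kP] := expr_beats_poly 4 0 th1.
rewrite mulr1 in kP.
(* as th ^ k >= 4, the bound (x / (k + 1)) ^ (k + 1) <= exp x at x = th ^ n / 4
   is at least 4 ^ n / C0 *)
pose C0 : R := (4 * k.+1%:R) ^+ k.+1.
have C00 : 0 <= C0 by rewrite exprn_ge0.
exists (4 * C0) => [|n]; first by rewrite mulr_ge0.
have one j : (P [set w | ((2 `^ (- h)) ^+ n < `|B (dyadic n j.+1) w - B (dyadic n j) w|)%R]
    <= (2 * (C0 / 4 ^+ n))%:E)%E.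
  have n0 : (0 : R) < 2 ^+ n by rewrite exprn_gt0.
  have dE : dyadic n j.+1 - dyadic n j = (2 ^- n : R).
    by rewrite /dyadic -mulrBl -natr1 addrC addKr mul1r.
  apply: le_trans (increment_tail _ _ _ _) _.
  - by rewrite divr_ge0// ltW.
  - by rewrite divr_ge0// ltW.
  - by rewrite eq_sym -subr_eq0 dE invr_neq0// gt_eqF.
  - by rewrite exprn_ge0// powR_ge0.
  rewrite lee_fin ler_pM2l// dE gtr0_norm ?invr_gt0//.
  have -> : ((2 `^ (- h)) ^+ n) ^+ 2 / (4 * (2 ^- n) `^ (2 * H)) = th ^+ n / 4 :> R.
    have two : 2 = expR (ln 2) :> R by rewrite lnK// posrE.
    have two_h : 2 `^ (- h) = expR (ln 2 * - h) by rewrite {1}two expRM.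
    have two_n : (2 ^- n) `^ (2 * H) = expR (- (n%:R * ln 2) * (2 * H)).
      by rewrite expRM expRN expRM_natl -two.
    have th_exp : th = expR (2 * ln 2 * (H - h)).
      by rewrite expRM expRM_natl -two -natrX.
    have frac (x y : R) : x / (4 * y) = x / y / 4 by rewrite invfM mulrA mulrAC.
    rewrite two_h two_n th_exp -!expRM_natl frac -expRN -expRD.
    by congr (expR _ / 4); ring.
  rewrite expRN -[leRHS]invrK lef_pV2 ?posrE ?expR_gt0 ?invr_gt0 ?divr_gt0 ?exprn_gt0//.
  apply: le_trans _ (expR_ge_expr k _); last by rewrite divr_ge0 ?exprn_ge0 ?ltW.
  rewrite -mulrA -invfM expr_div_n invfM invrK mulrC ler_wpM2r ?invr_ge0//.
  rewrite -exprM mulnC exprM lerXn2r ?nnegrE ?exprn_ge0 ?(ltW th0)//.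
  by apply: le_trans kP _; rewrite exprS ler_peMl ?exprn_ge0 ?(ltW th0)// ltW.
pose A j := [set w | ((2 `^ (- h)) ^+ n < `|B (dyadic n j.+1) w - B (dyadic n j) w|)%R].
rewrite /bad bigcup_mkord.
apply: le_trans (Boole_inequality P (A := A) (n := (2 ^ n)%N) _) _.
  by move=> j _; exact: measurable_increment_gt.
apply: (@le_trans _ _ (\sum_(j < (2 ^ n)%N) (2 * (C0 / 4 ^+ n))%:E)%E).
  by apply: lee_sum => j _; exact: one.
rewrite sumEFin lee_fin sumr_const card_ord -[leLHS]mulr_natl !natrX exprS.
have -> : 4 ^+ n = 2 ^+ n * 2 ^+ n :> R by rewrite -exprMn -natrM.
have : (2 ^+ n : R) != 0 by rewrite expf_neq0.
move: (2 ^+ n) => X X0; rewrite le_eqVlt; apply/orP; left; apply/eqP.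
by field.
Qed.

Lemma fbm_holder h : 0 < h < H ->
  {ae P, forall w, exists2 K : R, 0 <= K & forall x y, 0 <= x <= 1 -> 0 <= y <= 1 ->
    `|B x w - B y w| <= K * `|x - y| `^ h}.
Proof.
move=> hH; have /andP[h0 _] := hH.
have [C C0 CP] := bad_small hH.
have io0 : P (lim_sup_set (bad h)) = 0%E.
  apply: lim_sup_set_cvg0 => //.
  apply: le_lt_trans (ltry C); apply: le_trans (epsilon_trick0 xpredT C0).
  by apply: lee_nneseries => // n _; exact: CP.
have io : {ae P, forall w, ~ lim_sup_set (bad h) w}.
  exists (lim_sup_set (bad h)); split => //.
    apply: bigcapT_measurable => n; apply: bigcup_measurable => k _.
    exact: measurable_bad.
  by move=> w /contrapT.
have := fbm_continuous hB; apply: filterS2 io => w nio cont.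
have [N NP] : exists N, forall n, (N <= n)%N -> ~ bad h n w.
  apply: contrapT => nN; apply: nio => n _; apply: contrapT => nn.
  by apply: nN; exists n => k nk bk; apply: nn; exists k.
pose q : R := 2 `^ (- h); have q0 : 0 < q by rewrite powR_gt0.
pose D n j : R := `|B (dyadic n j.+1) w - B (dyadic n j) w|.
pose K : R := 1 + \sum_(n < N) \sum_(j < 2 ^ n) D n j / q ^+ n.
have term_ge0 n j : 0 <= D n j / q ^+ n
  by apply: divr_ge0; [exact: normr_ge0|rewrite exprn_ge0// ltW].
have K1 : 1 <= K.
  by rewrite lerDl; apply: sumr_ge0 => n _; apply: sumr_ge0.
apply: (@holder_of_dyadic R (fun t => B t w) h K) => //; first exact: le_trans K1.
- move=> x e /andP[x0 x1] e0.
  have /subspace_continuousP/(_ x) := cont.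
  rewrite /= in_itv/= x0 => /(_ isT)/cvgrPdist_lt/(_ e e0).
  move=> /nbhs_ballP[d /= d0 dP]; exists d => // y /andP[y0 y1] xy.
  by apply: dP; rewrite //= in_itv/= y0.
- move=> n j jn; rewrite -/q -/(D n j) -ler_pdivrMr ?exprn_gt0//.
  have [Nn|nN] := leqP N n.
    apply: le_trans K1; rewrite ler_pdivrMr ?exprn_gt0// mul1r leNgt; apply/negP => gt.
    by apply: (NP n Nn); exists j.
  rewrite /K (bigD1 (Ordinal nN))//= (bigD1 (Ordinal jn))//=.
  rewrite ler_wpDl// -addrA ler_wpDr// addr_ge0//.
    by apply: sumr_ge0.
  by apply: sumr_ge0 => i _; apply: sumr_ge0.
Qed.

End BrownianPaths.

(** * Functions with bounded mean *)

Section BoundedMean.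
Context {R : realType} {disp : measure_display} {T : measurableType disp}.
Context (P : probability T R).
Implicit Types (f : T -> R) (m c M : R).

Definition mean_le f m :=
  [/\ measurable_fun setT f, (forall w, 0 <= f w) & (\int[P]_w (f w)%:E <= m%:E)%E].

Lemma mean_leW f m m' : m <= m' -> mean_le f m -> mean_le f m'.
Proof. by move=> mm' [mf f0 fm]; split=> //; rewrite (le_trans fm)// lee_fin. Qed.

Lemma mean_le0 : mean_le (fun=> 0) 0.
Proof. by split=> //; rewrite integral0. Qed.

Lemma mean_leD f g m m' : mean_le f m -> mean_le g m' ->
  mean_le (fun w => f w + g w) (m + m').
Proof.
move=> [mf f0 fm] [mg g0 gm]; split; first exact: measurable_funD.
  by move=> w; rewrite addr_ge0.
under eq_integral do rewrite EFinD.
rewrite ge0_integralD//; first by rewrite EFinD leeD.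
- by move=> w _; rewrite lee_fin.
- exact/measurable_EFinP.
- by move=> w _; rewrite lee_fin.
- exact/measurable_EFinP.
Qed.

Lemma mean_le_scale f m c : 0 <= c -> mean_le f m ->
  mean_le (fun w => c * f w) (c * m).
Proof.
move=> c0 [mf f0 fm]; split; first exact: measurable_funM.
  by move=> w; rewrite mulr_ge0.
under eq_integral do rewrite EFinM.
rewrite ge0_integralZl_EFin//.
- by rewrite EFinM lee_wpmul2l.
- by move=> w _; rewrite lee_fin.
- exact/measurable_EFinP.
Qed.

Lemma mean_le_sum (I : Type) (s : seq I) (Q : pred I) (f : I -> T -> R) (m : I -> R) :
  (forall i, Q i -> mean_le (f i) (m i)) ->
  mean_le (fun w => \sum_(i <- s | Q i) f i w) (\sum_(i <- s | Q i) m i).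
Proof.
move=> fm; elim: s => [|i s IH].
  by rewrite big_nil; under [X in mean_le X _]eq_fun do rewrite big_nil; exact: mean_le0.
rewrite big_cons; under [X in mean_le X _]eq_fun do rewrite big_cons.
by case: ifPn => // Qi; apply: mean_leD => //; exact: fm.
Qed.

Lemma mean_le_indic (A : set T) m : measurable A -> (P A <= m%:E)%E ->
  mean_le (\1_A) m.
Proof. by move=> mA Am; split=> //; rewrite integral_indic// setIT. Qed.

(** If the means stay bounded, then by Fatou's lemma the inferior limit is
    almost surely finite, so some bound holds infinitely often. *)
Lemma bounded_infinitely_often (f : nat -> T -> R) m : (forall n, mean_le (f n) m) ->
  {ae P, forall w, exists M : R, forall n, exists2 k, (n <= k)%N & f k w <= M}.
Proof.
move=> fm; pose g n w : \bar R := (f n w)%:E.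
have mg n : measurable_fun setT (g n).
  by have [mf _ _] := fm n; exact/measurable_EFinP.
have g0 n w : setT w -> (0 <= g n w)%E.
  by have [_ f0 _] := fm n; rewrite lee_fin.
have fat : (\int[P]_w limn_einf (g^~ w) <= m%:E)%E.
  apply: le_trans (fatou P measurableT mg g0) _.
  rewrite limn_einf_lim; apply: lime_le; first exact: is_cvg_einfs.
  apply: nearW => n; apply: (@le_trans _ _ (\int[P]_w g n w)%E); last by have [] := fm n.
  by apply: ereal_inf_lbound; exists n => /=.
have liminf_ge0 w : (0 <= limn_einf (g^~ w))%E.
  rewrite limn_einf_lim; apply: lime_ge; first exact: is_cvg_einfs.
  by apply: nearW => n; apply: le_ereal_inf_tmp => _ [k _ <-]; exact: g0.
have integrable_liminf : P.-integrable setT (fun w => limn_einf (g^~ w)).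
  apply/integrableP; split.
    apply: (measurableT_comp (f := -%E)); first exact: oppe_measurable.
    apply: measurable_fun_limn_esup => n.
    by apply: (measurableT_comp (f := -%E)); first exact: oppe_measurable.
  under eq_integral do rewrite gee0_abs//.
  exact: le_lt_trans fat (ltry m).
have := integrable_ae measurableT integrable_liminf; apply: filterS => w /(_ I) fin.
exists (fine (limn_einf (g^~ w)) + 1) => n; apply: contrapT => nex.
have : (limn_einf (g^~ w) + 1 <= limn_einf (g^~ w))%E.
  apply: (@le_trans _ _ (einfs (g^~ w) n)); last first.
    rewrite [leRHS]limn_einf_lim; apply: lime_ge; first exact: is_cvg_einfs.
    by exists n => // k /= nk; exact: nondecreasing_einfs.
  apply: le_ereal_inf_tmp => _ [k /= nk <-].
  rewrite -(fineK fin) -EFinD lee_fin leNgt; apply/negP => /ltW le_k.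
  by apply: nex; exists k.
by rewrite -(fineK fin) -EFinD lee_fin gerDl ler10.
Qed.

End BoundedMean.

(** * The energy of the sampled graph *)

Section PairSum.
Context {R : realType} (mu : probability (measurableTypeR R) R) (S : subsystem mu).
Local Notation a := (#|sub_index S|%:R : R).

(** Of the pairs of words of length n, the fraction a ^ (- k) has a common prefix
    of length at least k. *)
Lemma pair_sum_le (b : R) n : 0 <= b -> 0 < a ->
  \sum_(u <- words S n) \sum_(v <- words S n | u != v) b ^+ common_prefix u v <=
  (a ^+ n) ^+ 2 * \sum_(k < n) (b / a) ^+ k.
Proof.
move=> b0 a0; pose G (u v : seq (sub_index S)) := if u != v then b ^+ common_prefix u v else 0.
have G0 u v : 0 <= G u v by rewrite /G; case: ifP => // _; rewrite exprn_ge0.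
rewrite (eq_bigr (fun u => \sum_(v <- words S n) G u v)) => [|u _]; last first.
  by rewrite big_mkcond.
elim: n => [|n IH].
  by rewrite big_ord0 mulr0 /= !big_seq1 /G eqxx.
have Gstep i j u v : G (i :: u) (j :: v) <= (i == j)%:R * (b * G u v) + 1.
  rewrite /G eqseq_cons negb_and /=; have [_|_] /= := eqVneq i j; last first.
    by rewrite expr0 mul0r add0r.
  case: ifP => uv; rewrite mul1r; first by rewrite exprS lerDl.
  by rewrite mulr0 add0r.
have sumW (F : seq (sub_index S) -> R) :
    \sum_(u <- words S n.+1) F u = \sum_j \sum_(u <- words S n) F (j :: u).
  by rewrite [words S n.+1]/= big_allpairs_dep big_enum.
have card_words (c : R) : \sum_(u <- words S n) c = a ^+ n * c.
  by rewrite big_const_seq count_predT iter_addr_0 size_words -[LHS]mulr_natl natrX.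
rewrite sumW; under eq_bigr do under eq_bigr do rewrite sumW.
apply: (@le_trans _ _ (\sum_(i : sub_index S) \sum_(u <- words S n) \sum_(j : sub_index S)
    \sum_(v <- words S n)
    ((i == j)%:R * (b * G u v) + 1))).
  by do 4!(apply: ler_sum => ? _).
have card_index (c : R) : \sum_(j : sub_index S) c = a * c.
  by rewrite -(big_enum _ _ _ (fun=> c)) big_const_seq count_predT iter_addr_0 -cardE -[LHS]mulr_natl.
have inner (i : sub_index S) u :
    \sum_(j : sub_index S) \sum_(v <- words S n) ((i == j)%:R * (b * G u v) + 1) =
    b * \sum_(v <- words S n) G u v + a * a ^+ n.
  under eq_bigr do rewrite big_split/= card_words mulr1 -mulr_sumr.
  rewrite big_split/= card_index; congr (_ + _).
  rewrite (bigD1 i)//= eqxx mul1r [X in _ + X]big1 ?addr0; first by rewrite mulr_sumr.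
  by move=> j ji; rewrite eq_sym (negbTE ji) mul0r.
under eq_bigr do under eq_bigr do rewrite inner.
under eq_bigr do rewrite big_split/= card_words -mulr_sumr.
rewrite card_index mulrDr addrC.
rewrite big_ord_recl expr0 (eq_bigr (fun k : 'I_n => (b / a) * (b / a) ^+ k)) => [|k _]; last first.
  by rewrite lift0 exprS.
rewrite -mulr_sumr.
have -> : a * (a ^+ n * (a * a ^+ n)) = (a ^+ n.+1) ^+ 2 by rewrite !exprS; ring.
rewrite [leRHS]mulrDr mulr1 lerD2l.
apply: le_trans (ler_wpM2l _ (ler_wpM2l b0 IH)) _; first exact: ltW.
set s := \sum_(_ < _) _; rewrite le_eqVlt; apply/orP; left; apply/eqP.
rewrite (exprS _ n); field.
by rewrite gt_eqF.
Qed.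

End PairSum.

Section Energy.
Context {R : realType} (mu : probability (measurableTypeR R) R) (S : subsystem mu).
Context {disp : measure_display} {T : measurableType disp}.
Context (P : probability T R) (H : R) (B : R -> {RV P >-> R}).
Hypotheses (hB : is_fbm H B) (H0 : 0 < H).
Local Notation J := (sub_index S).
Local Notation rho := (sub_ratio S).
Local Notation pi := (sub_weight S).
Local Notation V := (mass_from0 mu).
Local Notation a := (#|J|%:R : R).
Implicit Types (u v : seq J) (g t : R) (w : T).

Let rho0 : 0 < rho. Proof. by have /andP[] := sub_ratio01 S. Qed.
Let rho1 : rho < 1. Proof. by have /andP[] := sub_ratio01 S. Qed.
Let pi0 : 0 < pi. Proof. exact: sub_weight_gt0. Qed.

Definition sample_point u : R := cylinder u 0.

Definition scale k : R := sub_gap S * rho ^+ k.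

Lemma scale_gt0 k : 0 < scale k.
Proof. by rewrite mulr_gt0 ?sub_gap_gt0// exprn_gt0. Qed.

(** A truncation of the Riesz kernel |z|^(-g), z the difference of the points of
    the graph over two sample points: a step function at the scales rho ^ k, of
    which the first n + 1 are kept. *)
Definition riesz_kernel g n u v w : R :=
  \sum_(k < n.+1 | `|sample_point u - sample_point v| < scale k)
    (rho `^ (- g)) ^+ k *
    \1_[set w | `|B (V (sample_point v)) w - B (V (sample_point u)) w| <= scale k] w.

Definition energy g n w : R :=
  ((a ^+ n) ^+ 2)^-1 *
  \sum_(u <- words S n) \sum_(v <- words S n | u != v) riesz_kernel g n u v w.

Lemma sample_point01 u : 0 <= sample_point u <= 1.
Proof. by apply: cylinder01; rewrite lexx ler01. Qed.

(** Two points whose cylinders split after l letters are at distance at least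
    of order rho ^ l, so that only the scales k < l contribute; and the increment
    of the Brownian motion has standard deviation at least of order pi ^ (l H). *)
Lemma riesz_kernel_mean g n u v : 1 < g -> size u = n -> size v = n -> u != v ->
  mean_le P (riesz_kernel g n u v)
    (sub_gap S / sub_gap_mass S `^ H / (rho `^ (1 - g) - 1) *
     (rho `^ (1 - g) / pi `^ H) ^+ common_prefix u v).
Proof.
move=> g1 un vn uv; set l := common_prefix u v.
have suv : size u = size v by rewrite un vn.
have ln : (l < n)%N by rewrite -un common_prefix_lt.
have [Dx Dm] := cylinder_apart suv uv.
have z0 : 0 < rho `^ (- g) by rewrite powR_gt0.
pose th := rho `^ (1 - g).
have thE : th = rho `^ (- g) * rho.
  by rewrite /th addrC powRD ?powRr1 ?(ltW rho0)// (gt_eqF rho0) implybT.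
have th1 : 1 < th.
  by rewrite /th /powR gt_eqF// expR_gt1 nmulr_rgt0 ?subr_lt0// ln_lt0// rho0.
pose sd := (sub_gap_mass S * pi ^+ l) `^ H.
have m0 : 0 < sub_gap_mass S * pi ^+ l.
  by rewrite mulr_gt0 ?sub_gap_mass_gt0// exprn_gt0.
have sd0 : 0 < sd by rewrite powR_gt0.
have /andP[Vu0 _] := mass_from0_01 mu (sample_point u).
have /andP[Vv0 _] := mass_from0_01 mu (sample_point v).
have neV : V (sample_point u) != V (sample_point v).
  by rewrite -subr_eq0 -normr_gt0; apply: lt_le_trans Dm.
have one k : mean_le P (\1_[set w | `|B (V (sample_point v)) w -
    B (V (sample_point u)) w| <= scale k]) (scale k / sd).
  apply: mean_le_indic; first exact: measurable_increment_le.
  apply: le_trans (increment_small hB Vu0 Vv0 neV (ltW (scale_gt0 k))) _.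
  rewrite lee_fin ler_pM2l ?scale_gt0// lef_pV2 ?posrE ?powR_gt0//; last first.
    by rewrite distrC; apply: lt_le_trans Dm.
  by rewrite distrC; apply: le_powR_base Dm; rewrite ltW.
apply: (@mean_leW _ _ _ _ _ (\sum_(k < n.+1 | `|sample_point u - sample_point v| < scale k)
    (rho `^ (- g)) ^+ k * (scale k / sd))); last first.
  apply: mean_le_sum => k _; apply: mean_le_scale (one k).
  by rewrite exprn_ge0// ltW.
apply: (@le_trans _ _ (sub_gap S / sd * \sum_(k < l) th ^+ k)).
  rewrite (big_ord_widen n.+1 (fun k => th ^+ k)) 1?ltnW ?(leq_trans ln)//.
  rewrite big_mkcond [X in _ <= _ * X]big_mkcond/= mulr_sumr; apply: ler_sum => k _.
  case: ifP => [small|_]; last first.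
    case: ifP; rewrite ?mulr0// mulr_ge0 ?divr_ge0 ?(ltW sd0)//.
      exact/ltW/sub_gap_gt0.
    by rewrite exprn_ge0// ltW// (lt_trans ltr01).
  have -> : (k < l)%N.
    rewrite ltnNge; apply/negP => lk; move: small; rewrite ltNge => /negP; apply.
    by apply: le_trans Dx; rewrite ler_pM2l ?sub_gap_gt0// ler_wiXn2l ?ltW.
  by rewrite thE exprMn /scale le_eqVlt; apply/orP; left; apply/eqP; ring.
rewrite [leRHS](_ : _ = sub_gap S / sd * (th ^+ l / (th - 1))); last first.
  rewrite /sd powRM ?(ltW (sub_gap_mass_gt0 S)) ?exprn_ge0 ?(ltW pi0)//.
  rewrite powR_expr ?(ltW pi0)// -/th expr_div_n invfM.
  by rewrite -!mulrA; congr (_ * _); congr (_ * _); rewrite mulrCA [RHS]mulrCA [z in _ * z]mulrC.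
rewrite ler_wpM2l ?divr_ge0 ?(ltW sd0) ?(ltW (sub_gap_gt0 S))//.
exact: geometric_sum_le_last.
Qed.

Lemma energy_mean g t : 1 < g -> g < 1 + t -> 1 <= a * pi `^ H * rho `^ t ->
  exists m, forall n, mean_le P (energy g n) m.
Proof.
move=> g1 gt press; have a0 : 0 < a.
  rewrite lt_neqAle ler0n andbT eq_sym; apply: contraTneq press => ->.
  by rewrite !mul0r -ltNge ltr01.
pose b := rho `^ (1 - g) / pi `^ H; have b0 : 0 < b by rewrite divr_gt0// powR_gt0.
pose C := sub_gap S / sub_gap_mass S `^ H / (rho `^ (1 - g) - 1).
have th1 : 1 < rho `^ (1 - g).
  by rewrite /powR gt_eqF// expR_gt1 nmulr_rgt0 ?subr_lt0// ln_lt0// rho0.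
have C0 : 0 <= C.
  by rewrite !divr_ge0 ?powR_ge0 ?(ltW (sub_gap_gt0 S))// subr_ge0 ltW.
(* the pressure condition makes the geometric series converge *)
have ba : 0 <= b / a < 1.
  rewrite divr_ge0 ?(ltW b0) ?(ltW a0)//= ltr_pdivrMr// mul1r ltr_pdivrMr ?powR_gt0//.
  apply: lt_le_trans (_ : rho `^ (- t) <= _).
    by rewrite /powR gt_eqF// ltr_expR ltr_nM2r ?ln_lt0 ?rho0//; lra.
  by rewrite powRN -div1r ler_pdivrMr ?powR_gt0.
exists (C * (1 - b / a)^-1) => n.
have an0 : 0 < (a ^+ n) ^+ 2 by rewrite !exprn_gt0.
apply: (@mean_leW _ _ _ _ _ (((a ^+ n) ^+ 2)^-1 *
    \sum_(u <- words S n) \sum_(v <- words S n | u != v) C * b ^+ common_prefix u v)).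
  under eq_bigr do rewrite -mulr_sumr.
  rewrite -mulr_sumr mulrCA ler_wpM2l// ler_pdivrMl//.
  apply: le_trans (pair_sum_le n (ltW b0) a0) _.
  by rewrite ler_pM2l// geometric_sum_le.
apply: mean_le_scale; first by rewrite invr_ge0 ltW.
rewrite big_seq; under [X in mean_le _ X _]eq_fun do rewrite big_seq.
apply: mean_le_sum => u uw; rewrite big_seq_cond.
under [X in mean_le _ X _]eq_fun do rewrite big_seq_cond.
apply: mean_le_sum => v /andP[vw uv].
by apply: riesz_kernel_mean => //; exact: word_size.
Qed.

(** If both points lie within distance q of each other, in both coordinates, then
    the kernel is at least of order q ^ (- g), unless q is below the finest
    scale. *)
Lemma riesz_kernel_ge g n u v w (q : R) : 0 <= g -> 0 < q -> scale n <= q -> q < scale 0 ->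
  `|sample_point u - sample_point v| <= q ->
  `|B (V (sample_point v)) w - B (V (sample_point u)) w| <= q ->
  (scale 1) `^ g * q `^ (- g) <= riesz_kernel g n u v w.
Proof.
move=> g0 q0 qn q_lt dx dy.
have : exists k, scale k <= q by exists n.
move=> /ex_minnP[k kq kmin].
have k0 : (0 < k)%N by rewrite lt0n; apply: contraTneq kq => ->; rewrite -ltNge.
have kn : (k.-1 < n.+1)%N by rewrite ltnS (leq_trans (leq_pred k))// kmin.
have qk : q < scale k.-1 by rewrite ltNge; apply/negP => /kmin; rewrite leqNgt prednK ?leqnn.
rewrite /riesz_kernel (bigD1 (Ordinal kn))/=; last exact: le_lt_trans qk.
apply: ler_wpDr.
  by apply: sumr_ge0 => j _; rewrite mulr_ge0 ?exprn_ge0 ?powR_ge0.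
rewrite indicE mem_set ?mulr1 => [|/=]; last by rewrite (le_trans dy) ?ltW.
have -> : (rho `^ (- g)) ^+ k.-1 = (scale 1) `^ g * (scale k) `^ (- g).
  have scaleX j : scale j `^ g = sub_gap S `^ g * (rho `^ g) ^+ j.
    by rewrite powRM ?exprn_ge0 ?(ltW rho0) ?(ltW (sub_gap_gt0 S))// powR_expr ?(ltW rho0).
  rewrite !powRN !scaleX -{2}(prednK k0) (exprS _ k.-1) expr1 exprVn.
  have : sub_gap S `^ g != 0 by rewrite gt_eqF// powR_gt0// sub_gap_gt0.
  have : (rho `^ g) ^+ k.-1 != 0 by rewrite expf_neq0// gt_eqF// powR_gt0.
  have : rho `^ g != 0 by rewrite gt_eqF// powR_gt0.
  move: (rho `^ g) (_ ^+ k.-1) (sub_gap S `^ g) => x y z x0 y0 z0.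
  by field; rewrite x0 y0 z0.
rewrite ler_wpM2l ?powR_ge0// !powRN lef_pV2 ?posrE ?powR_gt0 ?scale_gt0//.
by apply: le_powR_base => //; rewrite ltW ?scale_gt0.
Qed.

End Energy.

(** * Hausdorff measure and dimension in the plane *)

Section HausdorffTools.
Context {R : realType}.
Implicit Types (A U : set (R * R)) (x y : R * R) (s t g q delta : R).

Lemma dist2_ge1 x y : `|x.1 - y.1| <= dist2 x y.
Proof. by rewrite /dist2 -sqrtr_sqr ler_wsqrtr// lerDl sqr_ge0. Qed.

Lemma dist2_ge2 x y : `|x.2 - y.2| <= dist2 x y.
Proof. by rewrite /dist2 -[leLHS]sqrtr_sqr ler_wsqrtr// lerDr sqr_ge0. Qed.

Lemma dist2_le x y q : `|x.1 - y.1| <= q -> `|x.2 - y.2| <= q ->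
  dist2 x y <= 2 * q.
Proof.
move=> h1 h2; have q0 : 0 <= q := le_trans (normr_ge0 _) h1.
rewrite /dist2 -[leRHS]ger0_norm ?mulr_ge0// -sqrtr_sqr ler_wsqrtr//.
have sq z : `|z| <= q -> z ^+ 2 <= q ^+ 2.
  by move=> zq; rewrite -[leLHS]real_normK ?num_real// lerXn2r ?nnegrE.
by have := sq _ h1; have := sq _ h2; have := sqr_ge0 q; rewrite exprMn; lra.
Qed.

Lemma dist2_le_diam U x y : U x -> U y -> ((dist2 x y)%:E <= diam2 U)%E.
Proof. by move=> Ux Uy; apply: ereal_sup_ubound; exists (x, y). Qed.

Lemma diam2_le U q : (forall x y, U x -> U y -> dist2 x y <= q) ->
  (diam2 U <= q%:E)%E.
Proof. by move=> Uq; apply: ge_ereal_sup => _ [[x y] [/= Ux Uy] <-]; rewrite lee_fin Uq. Qed.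

Lemma diam2_fine U delta : U !=set0 -> (diam2 U <= delta%:E)%E ->
  exists q, [/\ 0 <= q <= delta, diam2 U = q%:E &
    forall x y, U x -> U y -> dist2 x y <= q].
Proof.
move=> [x Ux] Ud; have d0 : (0 <= diam2 U)%E.
  by apply: le_trans (dist2_le_diam Ux Ux); rewrite lee_fin sqrtr_ge0.
have fin : diam2 U \is a fin_num.
  by rewrite ge0_fin_numE// (le_lt_trans Ud)// ltry.
exists (fine (diam2 U)); rewrite fineK//; split=> //.
  by rewrite -!lee_fin fineK// d0.
by move=> y z Uy Uz; rewrite -lee_fin fineK// dist2_le_diam.
Qed.

Lemma hausdorff_gauge_ge0 s U : (0 <= hausdorff_gauge s U)%E.
Proof. by rewrite /hausdorff_gauge; case: ifP => // _; exact: poweR_ge0. Qed.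

Lemma hausdorff_gauge_le s U q : 0 <= s -> (diam2 U <= q%:E)%E ->
  (hausdorff_gauge s U <= (q `^ s)%:E)%E.
Proof.
move=> s0 Uq; rewrite /hausdorff_gauge; case: ifPn => [_|/set0P U0].
  by rewrite lee_fin powR_ge0.
have [d [/andP[d0 dq] -> _]] := diam2_fine U0 Uq.
by rewrite poweR_EFin lee_fin le_powR_base.
Qed.

Lemma hausdorff_content_ge0 s delta A : (0 <= hausdorff_content s delta A)%E.
Proof.
apply: le_ereal_inf_tmp => _ [U _ <-].
by apply: nneseries_ge0 => n _ _; exact: hausdorff_gauge_ge0.
Qed.

Lemma hausdorff_content_finite_cover s delta A (cover : seq (set (R * R))) :
  (forall x, A x -> exists2 U, U \in cover & U x) ->
  (forall U, U \in cover -> (diam2 U <= delta%:E)%E) ->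
  (hausdorff_content s delta A <= \sum_(U <- cover) hausdorff_gauge s U)%E.
Proof.
move=> coverA small; pose F := nth set0 cover.
have -> : (\sum_(U <- cover) hausdorff_gauge s U =
    \sum_(0 <= n <oo) hausdorff_gauge s (F n))%E.
  rewrite (@nneseries_split _ _ 0%N (size cover)) => [|k _]; last exact: hausdorff_gauge_ge0.
  rewrite add0n [X in (_ + X)%E]eseries0 ?adde0 => [|k ks _]; last first.
    by rewrite /F nth_default// /hausdorff_gauge eqxx.
  by rewrite (big_nth set0).
apply: ereal_inf_lbound; exists F => //; split=> [x /coverA[U Ucov Ux]|n].
  by exists (index U cover); rewrite // /F nth_index.
have [ns|ns] := ltnP n (size cover); first by apply: small; rewrite mem_nth.
by rewrite /F nth_default//; apply: diam2_le.
Qed.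

Lemma hausdorff_dim_le s A : 0 <= s ->
  (forall delta e : R, 0 < delta -> 0 < e -> (hausdorff_content s delta A <= e%:E)%E) ->
  (hausdorff_dim A <= s%:E)%E.
Proof.
move=> s0 content0; apply: ereal_inf_lbound; exists s => //; split=> //.
apply/eqP; rewrite eq_le; apply/andP; split.
  apply: ge_ereal_sup => _ [delta delta0 <-].
  by apply/lee_addgt0Pr => e e0; rewrite add0e content0.
apply: le_trans (hausdorff_content_ge0 s 1 A) _.
by apply: ereal_sup_ubound; exists 1 => /=.
Qed.

(** For sets of diameter at most 1, the gauge decreases with the exponent, so a
    lower bound for the sums with exponent g excludes all smaller exponents. *)
Lemma hausdorff_dim_ge g delta c A : 0 <= g -> 0 < delta <= 1 -> 0 < c ->
  (forall U : nat -> set (R * R), A `<=` \bigcup_n U n ->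
     (forall n, (diam2 (U n) <= delta%:E)%E) ->
     (c%:E <= \sum_(0 <= n <oo) hausdorff_gauge g (U n))%E) ->
  (g%:E <= hausdorff_dim A)%E.
Proof.
move=> g0 /andP[delta0 delta1] c0 sums; apply: le_ereal_inf_tmp => _ [s [s0 Hs0] <-].
rewrite lee_fin leNgt; apply/negP => sg.
have : (hausdorff_content s delta A < c%:E)%E.
  apply: le_lt_trans (_ : (hausdorff_measure s A < _)%E); last by rewrite Hs0 lte_fin.
  by apply: ereal_sup_ubound; exists delta.
move=> /ereal_inf_lt[_ [U [AU Ud] <-]]; apply/negP; rewrite -leNgt.
apply: le_trans (sums U AU Ud) _.
apply: lee_nneseries => [n _ _|n _]; first exact: hausdorff_gauge_ge0.
rewrite /hausdorff_gauge; case: ifPn => // /set0P U0.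
have [q [/andP[q0 qd] -> _]] := diam2_fine U0 (Ud n).
rewrite !poweR_EFin lee_fin; have [->|qn0] := eqVneq q 0.
  by rewrite powR0 ?powR_ge0// gt_eqF// (le_lt_trans s0).
by apply: ger_powR (ltW sg); rewrite lt_neqAle eq_sym qn0 q0 (le_trans qd).
Qed.

End HausdorffTools.

(** A finite form of Frostman's argument. If the energy of the uniform measure on
    W, for a kernel K that is at least kappa / D i for pairs in the same class i,
    is at most M, then the classes cannot be small: the mass x_i of a class
    satisfies 2 x_i <= l D_i + x_i ^ 2 / (l D_i), and for l = M / kappa + 1 the sum
    of x_i ^ 2 / D_i is at most l, where the diagonal pairs account for the 1. *)
Lemma frostman_finite {R : realType} (I X : eqType) (s : seq I) (W : seq X)
    (cls : X -> I) (D : I -> R) (K : X -> X -> R) (kappa M : R) :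
  uniq s -> uniq W -> (0 < size W)%N -> (forall x, x \in W -> cls x \in s) ->
  (forall i, 0 < D i) -> 0 < kappa -> (forall x y, 0 <= K x y) ->
  (forall x y, x \in W -> y \in W -> x != y -> cls x = cls y ->
     kappa <= K x y * D (cls x)) ->
  (forall i, i \in s -> 1 <= (size W)%:R * D i) ->
  \sum_(x <- W) \sum_(y <- W | x != y) K x y <= M * (size W)%:R ^+ 2 -> 0 <= M ->
  1 <= (M / kappa + 1) * \sum_(i <- s) D i.
Proof.
move=> su Wu W0 clsP D0 kappa0 K0 Kge Dge energy M0.
set L := (size W)%:R : R; have L0 : 0 < L by rewrite ltr0n.
pose ind x i : R := (cls x == i)%:R.
pose c i := \sum_(x <- W) ind x i.
have sum_c : \sum_(i <- s) c i = L.
  rewrite exchange_big/= big_seq (eq_bigr (fun=> 1)) => [|x xW]; last first.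
    rewrite /ind (bigD1_seq (cls x)) ?clsP//= eqxx big1 ?addr0// => i.
    by rewrite eq_sym => /negbTE->.
  by rewrite -big_seq big_const_seq count_predT iter_addr_0.
have pair x y : x \in W -> y \in W -> x != y ->
    \sum_(i <- s) ind x i * ind y i / D i <= K x y / kappa.
  move=> xW yW xy; rewrite (bigD1_seq (cls x)) ?clsP//= big1 ?addr0 => [|i].
    rewrite /ind eqxx mul1r; have [yx|_] := eqVneq (cls y) (cls x).
      by rewrite mul1r -[_^-1]mul1r ler_pdivrMr// mulrAC ler_pdivlMr// mul1r Kge.
    by rewrite mul0r divr_ge0// ltW.
  by rewrite /ind eq_sym => /negbTE->; rewrite !mul0r.
have diag x : x \in W -> \sum_(i <- s) ind x i * ind x i / D i <= L.
  move=> xW; rewrite (bigD1_seq (cls x)) ?clsP//= big1 ?addr0 => [|i].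
    by rewrite /ind eqxx !mul1r -div1r ler_pdivrMr// Dge// clsP.
  by rewrite /ind eq_sym => /negbTE->; rewrite !mul0r.
have squares : \sum_(i <- s) c i ^+ 2 / D i <= (M / kappa + 1) * L ^+ 2.
  have -> : \sum_(i <- s) c i ^+ 2 / D i =
      \sum_(x <- W) \sum_(y <- W) \sum_(i <- s) ind x i * ind y i / D i.
    under [RHS]eq_bigr do rewrite exchange_big/=.
    rewrite exchange_big/=; apply: eq_bigr => i _.
    rewrite expr2 /c big_distrlr/= mulr_suml; apply: eq_bigr => x _.
    by rewrite mulr_suml.
  have row x : x \in W -> \sum_(y <- W) \sum_(i <- s) ind x i * ind y i / D i <=
      L + (\sum_(y <- W | x != y) K x y) / kappa.
    move=> xW; rewrite (bigD1_seq x)//=; apply: lerD; first exact: diag.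
    rewrite mulr_suml big_seq_cond [leRHS]big_seq_cond.
    rewrite [leRHS](eq_bigl (fun y => (y \in W) && (y != x))) => [|y]; last first.
      by rewrite (eq_sym x).
    by apply: ler_sum => y /andP[yW yx]; apply: pair; rewrite // eq_sym.
  rewrite big_seq; apply: le_trans (ler_sum _ row) _; rewrite -big_seq big_split/=.
  rewrite big_const_seq count_predT iter_addr_0 -[X in X + _]mulr_natl -/L -mulr_suml.
  have := energy; rewrite -/L -(ler_pM2r (x := kappa^-1)) ?invr_gt0//.
  by lra.
have lam0 : 0 < M / kappa + 1 by rewrite ltr_wpDl ?divr_ge0// ltW.
set lam := M / kappa + 1 in squares lam0 *.
have amgm i : 2 * c i * L <= lam * D i * L ^+ 2 + c i ^+ 2 / D i / lam.
  have Di := D0 i; set q := lam * D i; have q0 : 0 < q by rewrite mulr_gt0.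
  have -> : c i ^+ 2 / D i / lam = c i ^+ 2 / q.
    by rewrite -mulrA -invfM (mulrC (D i)).
  rewrite -subr_ge0.
  have -> : q * L ^+ 2 + c i ^+ 2 / q - 2 * c i * L = (q * L - c i) ^+ 2 / q.
    by field; rewrite gt_eqF.
  by rewrite divr_ge0 ?sqr_ge0 ?ltW.
have := ler_sum s (fun i (_ : true) => amgm i).
rewrite big_split/= -!mulr_suml -!mulr_sumr sum_c.
have : (\sum_(i <- s) c i ^+ 2 / D i) / lam <= L ^+ 2.
  by rewrite ler_pdivrMr// mulrC.
have L2 : 0 < L ^+ 2 by rewrite exprn_gt0.
move=> h1 h2; rewrite -(ler_pM2r L2) mul1r.
move: h1 h2; rewrite expr2; lra.
Qed.

(** * Continuity of the time change *)

Section Atomless.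
Context {R : realType} {m : nat} (r d p : 'I_m -> R).
Hypotheses (hifs : is_ifs r d) (hcosc : convex_open_set_condition r d).
Hypothesis hp : is_prob_vector p.
Context (mu : probability (measurableTypeR R) R).
Hypothesis hmu : is_self_similar_measure r d p mu.
Implicit Types (x y e : R).
Local Notation atom x := (mass mu [set x]).

Let r0 i : 0 < r i. Proof. by have /andP[] := ifs_ratio hifs i. Qed.
Let p0 i : 0 < p i. Proof. by have [+ _] := hp; apply. Qed.
Let p_lt1 i : p i < 1.
Proof. by have [_ p1] := hp; exact: prob_vector_lt1 (ifs_size hifs hp) p0 p1 i. Qed.

Lemma atomE x : atom x = \sum_(i < m) p i * atom ((x - d i) / r i).
Proof.
rewrite (self_similar_massE hmu)//; apply: eq_bigr => i _; congr (_ * mass mu _).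
apply/seteqP; split=> y /=; rewrite /ifs_map.
  by move=> <-; rewrite addrK mulrC mulKf// gt_eqF.
by move=> ->; rewrite mulrC divfK ?subrK// gt_eqF.
Qed.

Lemma atom_outside x : ~ (0 <= x <= 1) -> atom x = 0.
Proof.
move=> nx; apply/eqP; apply: contrapT => /negP.
by move=> /(self_similar_mass_meets hifs hcosc hp hmu (measurable_set1 x))[y ->].
Qed.

(** An end point of [0, 1] has only one preimage in [0, 1], namely itself. *)
Lemma atom_ends : atom 0 = 0 /\ atom 1 = 0.
Proof.
have m1 := ifs_size hifs hp; have m0 := ltnW m1.
have fixed i x : (forall j, j != i -> ~ (0 <= (x - d j) / r j <= 1)) ->
    (x - d i) / r i = x -> atom x = 0.
  move=> out fx; apply/eqP; have := atomE x; rewrite (bigD1 i)//= fx big1 => [|j ji].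
    by move/eqP; rewrite addr0 -subr_eq0 -{1}[atom x]mul1r -mulrBl mulf_eq0 subr_eq0 gt_eqF.
  by rewrite (atom_outside (out j ji)) mulr0.
split.
- apply: (fixed (Ordinal m0)) => [j j0|]; last first.
    by rewrite (ifs_first hifs)// subr0 mul0r.
  have lt_j : ((Ordinal m0 : 'I_m) < j)%N by rewrite lt0n; rewrite -val_eqE in j0.
  have := ifs_ordered hifs hcosc lt_j; rewrite /ifs_map mulr1 mulr0 add0r.
  rewrite (ifs_first hifs (i := Ordinal m0))// addr0 => le_d.
  move=> /andP[+ _]; rewrite ler_pdivlMr// mul0r sub0r.
  by have := r0 (Ordinal m0); lra.
- have mE : m.-1.+1 = m by rewrite prednK.
  have mP : (m.-1 < m)%N by rewrite mE.
  have dl : d (Ordinal mP) = 1 - r (Ordinal mP) by exact: (ifs_last hifs).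
  apply: (fixed (Ordinal mP)) => [j jl|]; last first.
    by rewrite dl subKr divff// gt_eqF.
  have lt_j : (j < Ordinal mP)%N.
    by rewrite ltn_neqAle -ltnS /= mE ltn_ord andbT; rewrite -val_eqE in jl.
  have := ifs_ordered hifs hcosc lt_j; rewrite /ifs_map mulr1 mulr0 add0r dl => le_d.
  move=> /andP[_]; rewrite ler_pdivrMr// mul1r.
  by have := r0 (Ordinal mP); lra.
Qed.

(** A point with two preimages in [0, 1] is a common end point of two adjacent
    images, so these preimages are end points of [0, 1], which carry no mass. Hence
    the mass of an atom is at most p_i times the mass of another one, for some i. *)
Lemma self_similar_atomless x : atom x = 0.
Proof.
have [f f0 fp] : exists2 f : R, 0 < f & forall i, f <= 1 - p i.
  by apply: finite_pos_lower_bound => i; rewrite subr_gt0.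
have m0 : (0 < m)%N := ltnW (ifs_size hifs hp).
pose l := 1 - f; have pl i : p i <= l by have := fp i; rewrite /l; lra.
have l0 : 0 < l by apply: lt_le_trans (pl (Ordinal m0)).
have l1 : l < 1 by rewrite /l; lra.
have [at0 at1] := atom_ends.
have unique (i j : 'I_m) y : (i < j)%N -> atom ((y - d i) / r i) != 0 ->
    atom ((y - d j) / r j) != 0 -> False.
  move=> ij ai aj.
  have in01 z : atom z != 0 -> 0 <= z <= 1.
    by move=> az; apply: contrapT => /atom_outside az0; rewrite az0 eqxx in az.
  have /andP[_ i1] := in01 _ ai; have /andP[j0 _] := in01 _ aj.
  have := ifs_ordered hifs hcosc ij; rewrite /ifs_map mulr1 mulr0 add0r => le_ij.
  have yi : (y - d i) / r i = 1.
    apply/eqP; rewrite eq_le i1 ler_pdivlMr// mul1r.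
    by move: j0; rewrite ler_pdivlMr// mul0r; lra.
  by rewrite yi at1 eqxx in ai.
have decay n y : atom y <= l ^+ n.
  elim: n y => [|n IH] y; first by rewrite expr0 mass_le1.
  have [/forallP all0|] := boolP [forall i, atom ((y - d i) / r i) == 0].
    rewrite atomE big1 ?exprn_ge0 ?(ltW l0)// => i _.
    by rewrite (eqP (all0 i)) mulr0.
  rewrite negb_forall => /existsP[i ai].
  rewrite atomE (bigD1 i)//= big1 ?addr0 => [|j ji]; last first.
    have [->|aj] := eqVneq (atom ((y - d j) / r j)) 0; first by rewrite mulr0.
    exfalso; move: ji; rewrite -val_eqE neq_ltn => /orP[lt_ji|lt_ij].
      exact: (unique _ _ _ lt_ji aj ai).
    exact: (unique _ _ _ lt_ij ai aj).
  by rewrite exprS ler_pM ?mass_ge0// ltW.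
apply/eqP; rewrite eq_le mass_ge0 andbT leNgt; apply/negP => a0.
have [|n nP] := @expr_beats_poly R l^-1 (2 / atom x) 0; first by rewrite invf_gt1.
have := decay n x; move: nP; rewrite mulr1 exprVn ler_pdivrMr// ler_pdivlMl ?exprn_gt0//.
have : 0 < l ^+ n by rewrite exprn_gt0.
lra.
Qed.

Lemma mass_from0_continuous x e : 0 <= x -> 0 < e -> exists2 q : R, 0 < q &
  forall y, 0 <= y -> `|x - y| < q -> `|mass_from0 mu x - mass_from0 mu y| < e.
Proof.
move=> x0 e0.
pose F (n : nat) : set (measurableTypeR R) :=
  `[x - n.+1%:R^-1, x + n.+1%:R^-1]%classic.
have mF n : measurable (F n) by exact: measurable_itv.
have : mu (F n) @[n --> \oo] --> mu (\bigcap_n F n).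
  apply: nonincreasing_cvg_mu => //.
  - by rewrite (le_lt_trans (probability_le1 _ _))// ltry.
  - exact: bigcapT_measurable.
  - move=> i j ij; apply/subsetPset => z; rewrite /F /= !in_itv/=.
    have : j.+1%:R^-1 <= i.+1%:R^-1 :> R by rewrite lef_pV2 ?posrE// ler_nat.
    by move: (_.+1%:R^-1) (_.+1%:R^-1) => a b ab /andP[? ?]; apply/andP; split; lra.
have -> : \bigcap_n F n = [set x].
  apply/seteqP; split=> [z Fz|z -> n _]; last first.
    rewrite /F /= in_itv/=; have : (0 : R) < n.+1%:R^-1 by rewrite invr_gt0.
    by move: (_.+1%:R^-1) => a a0; apply/andP; split; lra.
  apply/eqP; rewrite -subr_eq0 -normr_le0; apply/ler_addgt0Pr => f f0; rewrite add0r.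
  have := Fz (Num.truncn f^-1) I; rewrite /F /= in_itv/=.
  have : (Num.truncn f^-1).+1%:R^-1 <= f.
    by rewrite -[leRHS]invrK lef_pV2 ?posrE ?invr_gt0// ltW// truncnS_gt.
  by move: (_.+1%:R^-1) => a af /andP[? ?]; rewrite ler_norml; apply/andP; split; lra.
rewrite massE// self_similar_atomless => /fine_cvgP[_] /cvgrPdist_lt /(_ e e0)[N _ NP].
have small : mass mu (F N) < e.
  by have := NP N (leqnn N); rewrite /= sub0r normrN ger0_norm// mass_ge0.
exists N.+1%:R^-1; first by rewrite invr_gt0.
have ordered (a b : R) : 0 <= a -> a <= b -> F N a -> F N b ->
    `|mass_from0 mu a - mass_from0 mu b| < e.
  move=> a0 ab Fa Fb; rewrite distrC ger0_norm ?subr_ge0 ?mass_from0_le//.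
  rewrite mass_from0B//; apply: le_lt_trans small.
  apply: (le_mass mu (measurable_itv _) (mF N)) => z.
  move: Fa Fb; rewrite /F /= !in_itv/=.
  by move: (_.+1%:R^-1) => q /andP[? _] /andP[_ ?] /andP[? ?]; apply/andP; split; lra.
have Fx : F N x.
  rewrite /F /= in_itv/=; have : (0 : R) < N.+1%:R^-1 by rewrite invr_gt0.
  by move: (_.+1%:R^-1) => a a0; apply/andP; split; lra.
move=> y y0 xy; have Fy : F N y.
  move: xy; rewrite /F /= in_itv/= ltr_norml; move: (_.+1%:R^-1) => a /andP[? ?].
  by apply/andP; split; lra.
have [le_xy|/ltW le_yx] := leP x y; first exact: ordered.
by rewrite distrC; exact: ordered.
Qed.

(** The closed intervals of a regular grid split, by parity, into two families of
    disjoint intervals. *)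
Lemma grid_moment_bound h t : 0 < h <= 1 -> 0 <= t -> pressure_sum r p h t <= 1 ->
  exists2 C : R, 0 < C & forall n, \sum_(k < n.+1)
    mass mu `[k%:R / n.+1%:R, k.+1%:R / n.+1%:R] `^ h <= C * n.+1%:R `^ t.
Proof.
move=> h01 t0 press.
have [C C0 CP] := packing_moment_bound hifs hcosc hp hmu h01 t0 press.
exists (2 * C * 2 `^ t) => [|n]; first by rewrite !mulr_gt0 ?powR_gt0.
set N : R := n.+1%:R; have N0 : 0 < N by rewrite ltr0n.
pose rho := (2 * N)^-1; have rho0 : 0 < rho by rewrite invr_gt0 mulr_gt0.
pose ctr (k : nat) : R := (k.*2.+1)%:R * rho.
have itvE (k : nat) : `[k%:R / N, k.+1%:R / N]%classic = `[ctr k - rho, ctr k + rho]%classic.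
  have -> : k%:R / N = ctr k - rho.
    by rewrite /ctr /rho -natr1 -muln2 natrM; field; rewrite gt_eqF.
  have -> // : k.+1%:R / N = ctr k + rho.
  by rewrite /ctr /rho -!natr1 -muln2 natrM; field; rewrite gt_eqF.
pose fam (Q : pred nat) := [seq ctr k | k <- iota 0 n.+1 & Q k].
have famP (Q : pred nat) : (forall k l, Q k -> Q l -> (k < l)%N -> (k.+2 <= l)%N) ->
    \sum_(c <- fam Q) mass mu `[c - rho, c + rho] `^ h <= C * rho `^ (- t).
  move=> Qgap; apply: CP.
    rewrite rho0/= /rho invf_le1 ?mulr_gt0// -natrM ler1n muln_gt0.
    by [].
  rewrite pairwise_map.
  apply: (@sub_in_pairwise _ Q ltn); last 2 first.
  - exact: filter_all.
  - by apply: pairwise_filter; rewrite -(sorted_pairwise ltn_trans) iota_ltn_sorted.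
  move=> k l Qk Ql /= kl; have := Qgap k l Qk Ql kl; rewrite -(ler_nat R) -addn2 natrD => gap.
  rewrite distrC /ctr -mulrBl normrM (gtr0_norm rho0) ltr_pM2r//.
  rewrite (lt_le_trans _ (ler_norm _))// -!natr1 -!muln2 !natrM; lra.
have -> : \sum_(k < n.+1) mass mu `[k%:R / N, k.+1%:R / N] `^ h =
    \sum_(c <- fam odd) mass mu `[c - rho, c + rho] `^ h +
    \sum_(c <- fam (predC odd)) mass mu `[c - rho, c + rho] `^ h.
  rewrite -(big_mkord xpredT (fun k : nat => mass mu `[k%:R / N, k.+1%:R / N] `^ h)).
  rewrite (bigID odd)/= /fam !big_map !big_filter /index_iota subn0.
  by congr (_ + _); apply: eq_bigr => k _; rewrite itvE.
have -> : 2 * C * 2 `^ t * N `^ t = C * rho `^ (- t) + C * rho `^ (- t).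
  rewrite powRN /rho -(@powR_inv1 R (2 * N)) ?mulr_ge0 ?(ltW N0)//.
  rewrite -powRrM mulN1r powRN invrK powRM ?(ltW N0)//; ring.
by apply: lerD; apply: famP => k l /=; lia.
Qed.

End Atomless.

(** * Dimension bounds for one path *)

Section GraphUpper.
Context {R : realType}.
Implicit Types (X : R -> R) (t u C : R).

(** Over an interval of length 1 / N on which X stays within o of one value, the
    graph is covered by at most 2 o N + 1 squares of side 1 / N. *)
Lemma graph_dim_le X t u C (osc : nat -> nat -> R) : 0 <= t -> t < u -> 0 <= C ->
  (forall n k x, (k < n.+1)%N -> k%:R / n.+1%:R <= x <= k.+1%:R / n.+1%:R ->
     `|X x - X (k%:R / n.+1%:R)| <= osc n k) ->
  (forall n, \sum_(k < n.+1) osc n k <= C * n.+1%:R `^ t) ->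
  (hausdorff_dim (graph_on X `[0%R, 1%R]) <= (1 + u)%:E)%E.
Proof.
move=> t0 tu C0 oscP oscC; have u0 : 0 < u := le_lt_trans t0 tu.
have ut0 : 0 < u - t by rewrite subr_gt0.
apply: hausdorff_dim_le => [|delta e delta0 e0]; first by rewrite addr_ge0// ltW.
pose E := 2 `^ (1 + u) * (2 * C + 1).
have E0 : 0 < E by rewrite mulr_gt0 ?powR_gt0// ltr_wpDl// mulr_ge0.
pose n := Num.truncn (Num.max (2 / delta) ((E / e) `^ (u - t)^-1)).
set N : R := n.+1%:R; have N0 : 0 < N by rewrite ltr0n.
have N1 : 1 <= N by rewrite ler1n.
have [Nd Ne] : 2 / N <= delta /\ E * N `^ (t - u) <= e.
  have : Num.max (2 / delta) ((E / e) `^ (u - t)^-1) < N by exact: truncnS_gt.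
  rewrite gt_max => /andP[/ltW h1 /ltW h2]; split.
    by move: h1; rewrite !ler_pdivrMr// mulrC.
  have Ee : E / e <= N `^ (u - t).
    have -> : E / e = ((E / e) `^ (u - t)^-1) `^ (u - t).
      by rewrite -powRrM mulVf ?gt_eqF// powRr1// divr_ge0// ltW.
    by apply: le_powR_base h2; rewrite ?powR_ge0// ltW.
  rewrite -opprB powRN ler_pdivrMr ?powR_gt0//.
  by move: Ee; rewrite ler_pdivrMr// mulrC.
pose y k : R := X (k%:R / N) - osc n k.
pose box (k l : nat) : set (R * R) := [set z | k%:R / N <= z.1 <= k.+1%:R / N /\
  y k + l%:R / N <= z.2 <= y k + l.+1%:R / N].
pose cnt k := Num.truncn (2 * osc n k * N).
have osc0 k : (k < n.+1)%N -> 0 <= osc n k.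
  move=> kn; apply: le_trans (oscP n k (k%:R / N) kn _); first exact: normr_ge0.
  by rewrite lexx ler_pM2r ?invr_gt0// ler_nat leqnSn.
pose cover := [seq box k l | k <- iota 0 n.+1, l <- iota 0 (cnt k).+1].
have box_diam k l : (diam2 (box k l) <= (2 / N)%:E)%E.
  apply: diam2_le => a b [/= /andP[a1 a1'] /andP[a2 a2']] [/= /andP[b1 b1'] /andP[b2 b2']].
  rewrite -natr1 mulrDl mul1r in a1' b1'; rewrite -natr1 mulrDl mul1r in a2' b2'.
  suff [h1 h2] : `|a.1 - b.1| <= N^-1 /\ `|a.2 - b.2| <= N^-1 by exact: dist2_le.
  rewrite !ler_norml; move: a1 b1 a2 b2 a1' b1' a2' b2'.
  move: (k%:R / N) (y k) (l%:R / N) (N^-1) => *.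
  by split; apply/andP; split; lra.
apply: (le_trans (hausdorff_content_finite_cover (cover := cover) _ _ _)).
- move=> _ [x /= + <-]; rewrite in_itv/= => /andP[x0 x1].
  have [k kn /andP[kx xk]] : exists2 k, (k < n.+1)%N & k%:R / N <= x <= k.+1%:R / N.
    have [x_lt1|x_ge1] := ltP x 1.
      exists (Num.truncn (x * N)).
        rewrite -(ltr_nat R); apply: le_lt_trans (_ : x * N < _).
          by rewrite truncn_le mulr_ge0// ltW.
        by rewrite gtr_pMl.
      rewrite ler_pdivrMr// ler_pdivlMr// truncn_le mulr_ge0 ?(ltW N0)//=.
      by rewrite ltW// truncnS_gt.
    exists n => //; have -> : x = 1 by apply/eqP; rewrite eq_le x1.
    by rewrite divff ?gt_eqF// lexx andbT ler_pdivrMr// mul1r ler_nat.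
  have : `|X x - X (k%:R / N)| <= osc n k by apply: oscP => //; rewrite kx.
  rewrite ler_norml => /andP[Xlo Xhi].
  pose v := (X x - y k) * N.
  have v0 : 0 <= v by rewrite mulr_ge0 ?(ltW N0)// /y; lra.
  have vhi : v <= 2 * osc n k * N by rewrite ler_pM2r// /y; lra.
  exists (box k (Num.truncn v)).
    apply/allpairsPdep; exists k, (Num.truncn v); split=> //.
      by rewrite mem_iota.
    by rewrite mem_iota /= add0n ltnS; exact: le_truncn.
  split; first by rewrite /= kx.
  rewrite /= -!lerBrDl; apply/andP; split; first by rewrite ler_pdivrMr// truncn_le.
  by rewrite -lerBlDl ler_pdivlMr// ltW// truncnS_gt.
- move=> _ /allpairsPdep[k [l [_ _ ->]]].
  by apply: le_trans (box_diam k l) _; rewrite lee_fin.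
rewrite big_allpairs_dep.
apply: (@le_trans _ _ (\sum_(k <- iota 0 n.+1) \sum_(l <- iota 0 (cnt k).+1)
    ((2 / N) `^ (1 + u))%:E)%E).
  apply: lee_sum => k _; apply: lee_sum => l _.
  by apply: hausdorff_gauge_le (box_diam k l); rewrite addr_ge0// ltW.
under eq_bigr do rewrite sumEFin big_const_seq count_predT iter_addr_0 size_iota.
rewrite sumEFin lee_fin; apply: le_trans Ne.
apply: (@le_trans _ _ ((2 / N) `^ (1 + u) * (2 * N * \sum_(k < n.+1) osc n k + N))).
  rewrite -[X in iota _ X]subn0 -/(index_iota 0 n.+1) big_mkord.
  have -> : 2 * N * \sum_(k < n.+1) osc n k + N = \sum_(k < n.+1) (2 * osc n k * N + 1).
    rewrite big_split/= sumr_const card_ord -/N; congr (_ + _).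
    by rewrite mulr_sumr; apply: eq_bigr => k _; rewrite mulrAC.
  rewrite mulr_sumr; apply: ler_sum => k _.
  rewrite -[leLHS]mulr_natr ler_wpM2l ?powR_ge0// -natr1 lerD2r truncn_le.
  by rewrite !mulr_ge0 ?(ltW N0)// osc0.
have Nt1 : 1 <= N `^ t.
  by rewrite -[leLHS](powRr0 N); exact: ler_powR.
apply: (@le_trans _ _ ((2 / N) `^ (1 + u) * ((2 * C + 1) * (N * N `^ t)))).
  rewrite ler_wpM2l ?powR_ge0// [leRHS]mulrDl mul1r lerD//; last by rewrite ler_peMr// ltW.
  by rewrite -!mulrA ler_pM2l// mulrCA ler_pM2l// oscC.
rewrite powRM ?invr_ge0 ?(ltW N0)// -(powR_inv1 (ltW N0)) -powRrM mulN1r.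
have -> : N * N `^ t = N `^ (1 + t).
  by rewrite powRD ?powRr1 ?(ltW N0)// (gt_eqF N0) implybT.
have -> : N `^ (t - u) = N `^ (- (1 + u)) * N `^ (1 + t).
  by rewrite -powRD ?(gt_eqF N0) ?implybT//; congr (_ `^ _); ring.
by rewrite /E le_eqVlt; apply/orP; left; apply/eqP; ring.
Qed.

End GraphUpper.

Section GraphLower.
Context {R : realType} (mu : probability (measurableTypeR R) R) (S : subsystem mu).
Context {disp : measure_display} {T : measurableType disp}.
Context (P : probability T R) (B : R -> {RV P >-> R}).
Local Notation V := (mass_from0 mu).
Implicit Types (g M : R) (w : T).

Lemma riesz_kernel_ge0 g n (u v : seq (sub_index S)) w :
  0 <= riesz_kernel B g n u v w.
Proof. by apply: sumr_ge0 => k _; rewrite mulr_ge0 ?exprn_ge0 ?powR_ge0. Qed.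

(** A countable cover is enlarged to an open one, from which finitely many sets
    are selected; for a large n these are coarser than the finest scale of the
    kernel, and the finite form of Frostman's argument applies to the sample
    points of level n. *)
Lemma graph_dim_ge g M w (X := fun t => B (V t) w) : 0 < g ->
  (1 < #|sub_index S|)%N ->
  (forall x e : R, 0 <= x <= 1 -> 0 < e -> exists2 q : R, 0 < q &
     forall y, 0 <= y <= 1 -> `|x - y| < q -> `|X x - X y| < e) ->
  (forall n, exists2 k, (n <= k)%N & energy S B g k w <= M) ->
  (g%:E <= hausdorff_dim (graph_on X `[0%R, 1%R]))%E.
Proof.
move=> g0 a1 cont io.
have sc0 : 0 < scale S 0 := scale_gt0 S 0.
pose kappa := scale S 1 `^ g; have kappa0 : 0 < kappa by rewrite powR_gt0// scale_gt0.
pose M' := Num.max M 0; have M'0 : 0 <= M' by rewrite le_max lexx orbT.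
pose L := M' / kappa + 1; have L0 : 0 < L by rewrite ltr_wpDl ?divr_ge0// ltW.
(* the enlargements of the sets of the cover contribute at most half of the lower
   bound 1 / L, and none exceeds the coarsest scale of the kernel *)
pose eps := Num.min (2 * L)^-1 ((scale S 0 / 2) `^ g).
have eps0 : 0 < eps by rewrite lt_min invr_gt0 mulr_gt0//= powR_gt0// divr_gt0.
pose delta := Num.min 1 (scale S 0 / 4).
have delta0 : 0 < delta by rewrite lt_min ltr01/= divr_gt0.
pose c := (2 `^ g * (2 * L))^-1; have c0 : 0 < c by rewrite invr_gt0 !mulr_gt0 ?powR_gt0.
apply: (@hausdorff_dim_ge _ _ delta c) => //; first exact: ltW.
  by rewrite delta0 ge_min lexx.
move=> U coverU Udelta.
have size_ex n : exists q, [/\ 0 <= q <= delta, hausdorff_gauge g (U n) = (q `^ g)%:E &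
    forall x y, U n x -> U n y -> dist2 x y <= q].
  have [U0|/set0P U0] := eqVneq (U n) set0.
    exists 0; split; first by rewrite lexx ltW.
      by rewrite /hausdorff_gauge U0 eqxx powR0// gt_eqF.
    by rewrite U0.
  have [q [q01 dE qP]] := diam2_fine U0 (Udelta n).
  by exists q; split=> //; rewrite /hausdorff_gauge; move/set0P: U0 => /negbTE->; rewrite dE.
have [siz sizP] := choice size_ex.
pose small n := (eps / (2 ^ n.+1)%:R) `^ g^-1.
have small0 n : 0 < small n by rewrite powR_gt0// divr_gt0// ltr0n expn_gt0.
have smallg n : small n `^ g = eps / (2 ^ n.+1)%:R.
  by rewrite -powRrM mulVf ?gt_eqF// powRr1// divr_ge0 ?(ltW eps0).
have small_lt n : small n < scale S 0.
  apply: le_lt_trans (_ : scale S 0 / 2 < _); last by rewrite ltr_pdivrMr// ltr_pMr// ltr1n.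
  have -> : scale S 0 / 2 = ((scale S 0 / 2) `^ g) `^ g^-1.
    by rewrite -powRrM divff ?gt_eqF// powRr1// divr_ge0// ltW.
  apply: le_powR_base; rewrite ?invr_ge0 ?(ltW g0)// ?divr_ge0 ?(ltW eps0)//.
  apply: (@le_trans _ _ eps); last by rewrite ge_min lexx orbT.
  by rewrite ler_pdivrMr ?ltr0n ?expn_gt0// ler_peMr ?(ltW eps0)// ler1n expn_gt0.
pose D n := Num.max (2 * siz n) (small n).
have D0 n : 0 < D n by rewrite lt_max small0 orbT.
have D_lt n : D n < scale S 0.
  rewrite gt_max small_lt andbT; have [/andP[_ le_d] _ _] := sizP n.
  move: le_d; rewrite le_min => /andP[_]; have := sc0; lra.
(* enlarging the n-th set by small n / 4 keeps it within distance D n *)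
pose W n := \bigcup_(e in [set e : R * R | [/\ 0 <= e.1 <= 1, U n (e.1, X e.1), 0 < e.2 &
    forall y, 0 <= y <= 1 -> `|e.1 - y| < e.2 ->
      `|e.1 - y| < small n / 4 /\ `|X e.1 - X y| < small n / 4]]) ball e.1 e.2.
have W_open n : open (W n) by apply: bigcup_open => e [_ _ e0 _]; exact: ball_open.
have W_cover x : 0 <= x <= 1 -> exists n, W n x.
  move=> x01; have [|n _ Unx] := coverU (x, X x); first by exists x; rewrite //= in_itv.
  have s4 : 0 < small n / 4 by rewrite divr_gt0.
  have [q q0 qP] := cont x _ x01 s4.
  exists n; exists (x, Num.min q (small n / 4)) => /=; last by apply: ballxx; rewrite lt_min q0.
  split=> //; first by rewrite lt_min q0.
  by move=> y y01; rewrite lt_min => /andP[xq xs]; split=> //; exact: qP.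
have W_close n x y : W n x -> W n y -> 0 <= x <= 1 -> 0 <= y <= 1 ->
    `|x - y| <= D n /\ `|X x - X y| <= D n.
  move=> [[e1 e2] /= [e01 Ue e20 eP] ex] [[f1 f2] /= [f01 Uf f20 fP] fy] x01 y01.
  rewrite /ball/= in ex fy.
  have [ex1 ex2] := eP x x01 ex; have [fy1 fy2] := fP y y01 fy.
  have [/andP[sz0 _] _ szP] := sizP n.
  have := szP _ _ Ue Uf; set dd := dist2 _ _ => ddle.
  have h1 : `|e1 - f1| <= siz n := le_trans (dist2_ge1 (e1, X e1) (f1, X f1)) ddle.
  have h2 : `|X e1 - X f1| <= siz n := le_trans (dist2_ge2 (e1, X e1) (f1, X f1)) ddle.
  have Dn : siz n + small n / 2 <= D n.
    by rewrite /D; have [h|h] := leP (2 * siz n) (small n); lra.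
  have tri (a b c' d : R) : `|b - a| < small n / 4 -> `|c' - d| < small n / 4 ->
      `|b - c'| <= siz n -> `|a - d| <= D n.
    have := ler_distD b a d; have := ler_distD c' b d; rewrite (distrC a b); lra.
  by split; [exact: tri ex1 fy1 h1|exact: tri ex2 fy2 h2].
have [s [s_uniq sW s_sum]] : exists s : seq nat, [/\ uniq s,
    forall x, 0 <= x <= 1 -> exists2 n, n \in s & W n x &
    forall f : nat -> \bar R, (forall n, (0 <= f n)%E) ->
      (\sum_(n <- s) f n <= \sum_(0 <= n <oo) f n)%E].
  have := @segment_compact R 0 1; rewrite compact_cover => /(_ nat setT W).
  case=> [n _||F _ FW]; first exact: W_open.
    by move=> x /=; rewrite in_itv/= => /W_cover[n Wn]; exists n.
  exists (finmap.enum_fset F); split; first exact: finmap.fset_uniq.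
    by move=> x x01; have [|n nF Wn] := FW x; [rewrite /= in_itv|exists n].
  by move=> f f0; apply: lee_sum_fset_lim.
have cls_ex (u : seq (sub_index S)) : exists n, n \in s /\ W n (sample_point u).
  by have [n ns Wn] := sW _ (sample_point01 u); exists n.
have [cls clsP] := choice cls_ex.
pose K := \max_(i <- s) i.
have small_ge n : n \in s -> small K <= small n.
  move=> ns; apply: le_powR_base; rewrite ?invr_ge0 ?(ltW g0) ?divr_ge0 ?(ltW eps0)//.
  rewrite ler_pM2l// lef_pV2 ?posrE ?ltr0n ?expn_gt0// ler_nat leq_exp2l//.
  by rewrite ltnS; exact: leq_bigmax_seq.
have /andP[rho0 rho1] := sub_ratio01 S.
have [|N1 N1P] := @expr_beats_poly R (sub_ratio S)^-1 (scale S 0 / small K) 0.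
  by rewrite invf_gt1.
have [|N2 N2P] := @expr_beats_poly R #|sub_index S|%:R (small K `^ g)^-1 0.
  by rewrite ltr1n.
rewrite !mulr1 in N1P N2P.
have [N NN Nen] := io (maxn N1 N2).
have scaleN : scale S N <= small K.
  apply: (@le_trans _ _ (scale S N1)).
    rewrite ler_pM2l ?sub_gap_gt0// ler_wiXn2l ?ltW//.
    by rewrite (leq_trans (leq_maxl N1 N2)).
  move: N1P; rewrite exprVn ler_pdivrMr// /scale expr0 mulr1.
  by rewrite ler_pdivlMl ?exprn_gt0// mulrC.
have L_large : 1 <= (size (words S N))%:R * small K `^ g.
  have sK : 0 < small K `^ g by rewrite powR_gt0.
  have sK0 : small K `^ g != 0 by rewrite gt_eqF.
  rewrite -[leLHS](mulVf sK0) ler_pM2r// size_words natrX; apply: le_trans N2P _.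
  by rewrite ler_weXn2l ?(leq_trans (leq_maxr N1 N2))// ler1n ltnW.
have frost : 1 <= L * \sum_(i <- s) D i `^ g.
  apply: (@frostman_finite _ nat (seq (sub_index S)) s (words S N) cls
    (fun n => D n `^ g) (fun u v => riesz_kernel B g N u v w)) => //.
  - exact: words_uniq.
  - by rewrite size_words expn_gt0 (ltnW a1).
  - by move=> u _; have [] := clsP u.
  - by move=> i; rewrite powR_gt0.
  - by move=> u v; exact: riesz_kernel_ge0.
  - move=> u v uW vW uv cuv; have [us Wu] := clsP u; have [_ Wv] := clsP v.
    rewrite -cuv in Wv.
    have [h1 h2] := W_close _ _ _ Wu Wv (sample_point01 u) (sample_point01 v).
    rewrite -ler_pdivrMr ?powR_gt0// -powRN; apply: riesz_kernel_ge => //.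
    + exact: ltW.
    + apply: le_trans scaleN _; apply: le_trans (small_ge _ us) _.
      by rewrite le_max lexx orbT.
    + by rewrite distrC.
  - move=> i si; apply: le_trans L_large _; rewrite ler_wpM2l//.
    apply: le_powR_base; rewrite ?(ltW g0) ?(ltW (small0 K))//.
    by apply: le_trans (small_ge _ si) _; rewrite le_max lexx orbT.
  - have L20 : 0 < ((#|sub_index S|%:R : R) ^+ N) ^+ 2.
      by rewrite !exprn_gt0// ltr0n ltnW.
    rewrite size_words natrX -ler_pdivrMr// mulrC; apply: le_trans Nen _.
    by rewrite le_max lexx.
have powR_max (a b : R) : Num.max a b `^ g <= a `^ g + b `^ g.
  by have [_|_] := leP a b; rewrite ?lerDl ?lerDr powR_ge0.
have sum_D : \sum_(i <- s) D i `^ g <= 2 `^ g * \sum_(i <- s) siz i `^ g + eps.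
  apply: (@le_trans _ _ (\sum_(i <- s) (2 `^ g * siz i `^ g + small i `^ g))).
    apply: ler_sum => i _; have [/andP[si0 _] _ _] := sizP i.
    by rewrite -(powRM _ (ler0n R 2) si0); exact: powR_max.
  rewrite big_split/= -mulr_sumr lerD2l -lee_fin -sumEFin.
  under eq_bigr do rewrite smallg.
  apply: le_trans (epsilon_trick0 xpredT (ltW eps0)).
  by apply: s_sum => n; rewrite lee_fin divr_ge0// ltW.
have c_le : c <= \sum_(i <- s) siz i `^ g.
  have eps_le : eps <= (2 * L)^-1 by rewrite ge_min lexx.
  have two0 : 0 < 2 `^ g :> R by rewrite powR_gt0.
  rewrite /c invfM ler_pdivrMl//.
  have : L^-1 <= 2 `^ g * \sum_(i <- s) siz i `^ g + eps.
    by apply: le_trans sum_D; rewrite -[leLHS]mulr1 ler_pdivrMl.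
  rewrite invfM in eps_le *; have : L^-1 = 2^-1 * L^-1 + 2^-1 * L^-1 by field; rewrite gt_eqF.
  lra.
apply: (@le_trans _ _ (\sum_(i <- s) hausdorff_gauge g (U i))%E).
  under eq_bigr => i _ do have [_ -> _] := sizP i.
  by rewrite sumEFin lee_fin.
by apply: s_sum => n; exact: hausdorff_gauge_ge0.
Qed.

End GraphLower.

(** * The almost sure dimension *)

Section TimeChange.
Context {R : realType} {m : nat} (r d p : 'I_m -> R).
Hypotheses (hifs : is_ifs r d) (hcosc : convex_open_set_condition r d).
Hypothesis hp : is_prob_vector p.
Context (mu : probability (measurableTypeR R) R).
Hypothesis hmu : is_self_similar_measure r d p mu.
Context (H : R) {disp : measure_display} {T : measurableType disp}.
Context (P : probability T R) (B : R -> {RV P >-> R}).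
Hypotheses (hB : is_fbm H B) (hH : 0 < H < 1).
Local Notation V := (mass_from0 mu).
Local Notation graph w := (graph_on (fun x => B (V x) w) `[0%R, 1%R]).
Implicit Types (s t g : R).

Let m0 : (0 < m)%N. Proof. exact: ltnW (ifs_size hifs hp). Qed.
Let r0 i : 0 < r i. Proof. by have /andP[] := ifs_ratio hifs i. Qed.
Let p0 i : 0 < p i. Proof. by have [+ _] := hp; apply. Qed.

(** The strict inequality leaves room to replace H by a smaller exponent, for
    which the paths are Hoelder continuous. *)
Lemma graph_dim_le_ae t u : 0 <= t -> t < u -> pressure_sum r p H t < 1 ->
  {ae P, forall w, (hausdorff_dim (graph w) <= (1 + u)%:E)%E}.
Proof.
move=> t0 tu press; have /andP[H0 H1] := hH.
have [h /andP[h0 hltH] hpress] : exists2 h, 0 < h < H & pressure_sum r p h t <= 1.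
  have [_ /(_ t H)] := pressure_sum_continuous p0 r0.
  move=> /cvgr_lt /(_ _ press) /nbhs_ballP[e /= e0 eP].
  pose q := Num.min e H.
  have q0 : 0 < q by rewrite lt_min e0.
  have qH : q <= H by rewrite ge_min lexx orbT.
  have qe : q <= e by rewrite ge_min lexx.
  exists (H - q / 2); first by apply/andP; split; lra.
  by apply/ltW/eP; rewrite /ball/= subKr gtr0_norm; lra.
have h01 : 0 < h <= 1 by rewrite h0 ltW// (lt_trans hltH).
have [C C0 CP] := grid_moment_bound hifs hcosc hp hmu h01 t0 hpress.
have hh : 0 < h < H by rewrite h0.
have := fbm_holder hB hh; apply: filterS => w [K K0 KP].
have V01 x : 0 <= V x <= 1 by exact: mass_from0_01.
pose osc n k := K * mass mu `[k%:R / n.+1%:R, k.+1%:R / n.+1%:R] `^ h.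
apply: (@graph_dim_le _ _ t u (K * C) osc) => //.
- by rewrite mulr_ge0// ltW.
- move=> n k x kn /andP[kx xk].
  have k0 : 0 <= k%:R / n.+1%:R :> R by rewrite divr_ge0.
  apply: le_trans (KP _ _ (V01 _) (V01 _)) _; rewrite ler_wpM2l//.
  apply: le_powR_base; rewrite ?(ltW h0)// mass_from0B// ger0_norm ?mass_ge0//.
  apply: le_mass => // z /=; rewrite !in_itv/= => /andP[/ltW-> zx].
  exact: le_trans xk.
- by move=> n; rewrite -mulr_sumr -mulrA ler_wpM2l.
Qed.

(** A subsystem whose pressure at t is at least 1 has bounded expected energy for
    every exponent g < 1 + t. *)
Lemma graph_dim_ge_ae t g : 0 < t -> 1 < g -> g < 1 + t ->
  1 < pressure_sum r p H t ->
  {ae P, forall w, (g%:E <= hausdorff_dim (graph w))%E}.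
Proof.
move=> t0 g1 gt press; have /andP[H0 H1] := hH; have g0 := lt_trans ltr01 g1.
have [S Spress] := exists_subsystem hifs hcosc hp hmu press.
have /andP[rho0 rho1] := sub_ratio01 S.
have pi1 : sub_weight S <= 1.
  have : (0 < #|sub_index S|)%N.
    rewrite lt0n; apply: contraTneq Spress => ->.
    by rewrite !mul0r -ltNge ltr01.
  move=> /card_gt0P[j _].
  have := sub_map_mass j measurableT; rewrite preimage_setT.
  by rewrite /mass !probability_setT/= mulr1.
have a1 : (1 < #|sub_index S|)%N.
  rewrite -(ltr_nat R); apply: lt_le_trans (_ : 1 < (sub_ratio S `^ t)^-1) _.
    rewrite invf_gt1 ?powR_gt0// /powR gt_eqF// -expR0 ltr_expR.
    by rewrite pmulr_rlt0// ln_lt0// rho0.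
  rewrite -div1r ler_pdivrMr ?powR_gt0//; apply: le_trans Spress _.
  rewrite ler_wpM2r ?powR_ge0// ler_piMr//.
  by apply: powR_le1; rewrite ?(ltW H0) ?(ltW (sub_weight_gt0 S)).
have [M MP] := energy_mean hB H0 g1 gt Spress.
have half : 0 < H / 2 < H by lra.
have := bounded_infinitely_often MP.
apply: filterS2 (fbm_holder hB half) => w [K K0 KP] [M' M'P].
apply: graph_dim_ge M'P => // x e /andP[x0 x1] e0.
have V01 y : 0 <= V y <= 1 by exact: mass_from0_01.
pose e' := (e / (K + 1)) `^ (H / 2)^-1.
have e'0 : 0 < e' by rewrite powR_gt0// divr_gt0// ltr_wpDl.
have [q q0 qP] := mass_from0_continuous hifs hcosc hp hmu x0 e'0.
exists q => // y /andP[y0 y1] xyq.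
apply: le_lt_trans (KP _ _ (V01 x) (V01 y)) _.
have K1 : 0 < K + 1 by rewrite ltr_wpDl.
have : `|V x - V y| `^ (H / 2) <= e / (K + 1).
  have -> : e / (K + 1) = e' `^ (H / 2).
    by rewrite -powRrM mulVf ?powRr1 ?divr_ge0 ?(ltW e0) ?(ltW K1)// gt_eqF//; case/andP: half.
  by apply: le_powR_base; rewrite ?normr_ge0 ?(ltW (qP _ y0 xyq))//; case/andP: half => /ltW.
rewrite ler_pdivlMr// => le_e.
have [v0|v0] := eqVneq (`|V x - V y| `^ (H / 2)) 0; first by rewrite v0 mulr0.
have : 0 < `|V x - V y| `^ (H / 2) by rewrite lt_neqAle eq_sym v0 powR_ge0.
move: le_e; rewrite mulrC; nra.
Qed.

(** The exponents of the previous bounds may be taken arbitrarily close to 1 + s,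
    and countably many of them suffice. *)
Lemma graph_dim_ae s : 0 < s -> pressure_sum r p H s = 1 ->
  {ae P, forall w, hausdorff_dim (graph w) = (1 + s)%:E}.
Proof.
move=> s0 sE.
have up : {ae P, forall w (k : nat),
    (hausdorff_dim (graph w) <= (1 + (s + k.+1%:R^-1))%:E)%E}.
  apply/ae_foralln => k.
  have k0 : 0 < k.+1%:R^-1 :> R by rewrite invr_gt0.
  apply: (@graph_dim_le_ae (s + k.+1%:R^-1 / 2)).
  - by rewrite addr_ge0 ?divr_ge0// ltW.
  - by rewrite ltrD2l; move: k0; move: (_^-1) => a a0; lra.
  - rewrite -[ltRHS]sE; apply: pressure_sum_decreasing => //; first exact: ifs_ratio hifs.
    by rewrite ltrDl divr_gt0.
have low : {ae P, forall w (k : nat),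
    ((1 + (s - s / k.+2%:R))%:E <= hausdorff_dim (graph w))%E}.
  apply/ae_foralln => k.
  have k0 : 0 < s / k.+2%:R < s.
    by rewrite divr_gt0//= ltr_pdivrMr// ltr_pMr// ltr1n.
  apply: (@graph_dim_ge_ae (s - s / k.+2%:R / 2)).
  - by move: k0; move: (s / _) => a a0; lra.
  - by move: k0; move: (s / _) => a a0; lra.
  - by move: k0; move: (s / _) => a a0; lra.
  - rewrite -[ltLHS]sE; apply: pressure_sum_decreasing => //; first exact: ifs_ratio hifs.
    by move: k0; move: (s / _) => a a0; lra.
apply: filterS2 up low => w up low; apply/eqP; rewrite eq_le; apply/andP; split.
  apply/lee_addgt0Pr => e e0; apply: le_trans (up (Num.truncn e^-1)) _.
  rewrite -EFinD lee_fin addrA lerD2l invf_ple ?posrE//.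
  by rewrite ltW// truncnS_gt.
apply/lee_subgt0Pr => e e0; apply: le_trans (low (Num.truncn (s / e))).
rewrite -EFinB lee_fin -addrA lerD2l lerD2l lerN2.
rewrite ler_pdivrMr// mulrC -ler_pdivrMr//; apply/ltW/(lt_le_trans (truncnS_gt _)).
by rewrite ler_nat.
Qed.

End TimeChange.

Theorem theorem1p5 (R : realType) (H : R) (hH : 0 < H < 1)
    (m : nat) (r d p : 'I_m -> R)
    (hifs : is_ifs r d) (hcosc : convex_open_set_condition r d)
    (hp : is_prob_vector p)
    (mu : probability (measurableTypeR R) R)
    (hmu : is_self_similar_measure r d p mu)
    (disp : measure_display) (T : measurableType disp) (P : probability T R)
    (B : R -> {RV P >-> R}) (hB : is_fbm H B) :
  {ae P, forall w,
    hausdorff_dim (graph_on (fun t : R => B (mass_from0 mu t) w) `[0, 1])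
      = (1 - lq_spectrum mu H)%E}.
Proof.
have /andP[H0 H1] := hH; have [p0 p1] := hp.
have [s s0 sE] := pressure_root (ifs_size hifs hp) p0 p1 (ifs_ratio hifs) hH.
have H01 : 0 < H <= 1 by rewrite H0 ltW.
have := graph_dim_ae hifs hcosc hp hmu hB hH s0 sE; apply: filterS => w ->.
by rewrite (lq_spectrum_self_similar hifs hcosc hp hmu H01 s0 sE) -EFinB opprK.
Qed.
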